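(* Let $r = r(n)$ be a function from the positive integers to the non-negative integers satisfying $r(n) \le (\log n)^{1/4}$ for every $n \in \mathbb{N}$. Then almost all $K_{r+1}$-free graphs on $n$ vertices are $r$-partite. That is, for every $\varepsilon > 0$ there exists $n_0$ such that for every $n \ge n_0$, the number of $K_{r(n)+1}$-free graphs on $n$ vertices that are not $r(n)$-partite is at most $\varepsilon$ times the number of $K_{r(n)+1}$-free graphs on $n$ vertices.
   Context: Graphs on $n$ vertices are finite simple labelled graphs with vertex set $\{1,\dots,n\}$. $\log$ denotes the natural logarithm. A graph is $K_{r+1}$-free if it contains no clique on $r+1$ vertices, and $r$-partite if its vertex set can be partitioned into $r$ (possibly empty) independent sets, i.e. its chromatic number is at most $r$. *)

(* Defs.v *)
From mathcomp Require Import all_boot all_order all_algebra.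
From mathcomp Require Import reals exp.

Set Implicit Arguments.
Unset Strict Implicit.
Unset Printing Implicit Defensive.

(* A labelled simple graph on n vertices is given by its edge set, a set of
   2-element subsets of 'I_n; the vertex i : 'I_n stands for i + 1. *)
Definition is_graph (n : nat) (E : {set {set 'I_n}}) : bool :=
  [forall e in E, #|e| == 2].

Definition adj (n : nat) (E : {set {set 'I_n}}) (x y : 'I_n) : bool :=
  [set x; y] \in E.

Definition clique (n : nat) (E : {set {set 'I_n}}) (K : {set 'I_n}) : bool :=
  [forall x in K, forall y in K, (x != y) ==> adj E x y].

Definition independent (n : nat) (E : {set {set 'I_n}}) (S : {set 'I_n}) :
  bool := [forall x in S, forall y in S, ~~ adj E x y].

Definition Kfree (k n : nat) (E : {set {set 'I_n}}) : bool :=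
  ~~ [exists K : {set 'I_n}, (#|K| == k) && clique E K].

(* A partition into r possibly empty parts is encoded by the map f sending
   each vertex to the index of its part. *)
Definition partite (r n : nat) (E : {set {set 'I_n}}) : bool :=
  [exists f : {ffun 'I_n -> 'I_r},
    forall i : 'I_r, independent E [set x | f x == i]].

Definition Kfree_graphs (k n : nat) : {set {set {set 'I_n}}} :=
  [set E | is_graph E && Kfree k E].

Definition Kfree_nonpartite_graphs (k r n : nat) : {set {set {set 'I_n}}} :=
  [set E in Kfree_graphs k n | ~~ partite r E].

(* Main.v *)
Require Import Defs.
From mathcomp Require Import all_boot all_order all_algebra.
From mathcomp Require Import boolp reals sequences exp.
From mathcomp Require Import zify ring lra.

(* Idea: a Kleitman-Rothschild induction on the number of vertices.  Write f(m)
   and g(m) for the numbers of K_{r+1}-free and of r-partite graphs, and put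
   p = m/r.  Attaching k vertices to the smallest colour class gives
   g(m) >= 2^(k(m-k-p)) g(m-k), so a class of K_{r+1}-free graphs is negligible
   as soon as its members arise from smaller K_{r+1}-free graphs by adding k
   vertices in far fewer than 2^(k(m-k-p)) ways.  Two such classes suffice.

   (1) Some set A of slightly more than jp vertices does not contain "robustly
   many" (j+1)-cliques.  By a container argument a random w-subset W of A has
   at most about 2^(w-wp/|A|) subsets poor in j-cliques, while almost every
   vertex of A has a neighbourhood in W that is poor in j-cliques; hence there
   are few ways to attach W.

   (2) Outside class (1), containers give, for each vertex z of a set K of
   2r+1 vertices, a set B_z of about p vertices outside K missing the
   neighbourhood of z.  If two vertices x, y of K have no (r-1)-clique in their
   common neighbourhood and B_x, B_y overlap substantially, then there are few
   ways to attach K.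

   In the remaining graphs, "the common neighbourhood contains an (r-1)-clique"
   is an equivalence relation on vertices (up to reflexivity) with at most r
   classes, since the sets B_z of inequivalent vertices are almost disjoint;
   adjacent vertices are inequivalent, so the graph is r-partite. *)

Set Implicit Arguments.
Unset Strict Implicit.
Unset Printing Implicit Defensive.

(** * Robustly many cliques and containers *)

Section Rich.
Variables (V : finType) (N : V -> {set V}).

(* [rich 1 s X] says that X contains an s-clique; in general [rich h s X] yields
   at least h^s ordered s-cliques in X, with h choices at each of the s steps. *)
Fixpoint rich (h s : nat) (X : {set V}) : bool :=
  if s is s'.+1 then h <= #|[set x in X | rich h s' (X :&: N x)]| else true.

Definition high (h s : nat) (X : {set V}) : {set V} :=
  [set x in X | rich h s (X :&: N x)].

(* All the sets of candidates for the next vertex, over all ways of fixing the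
   first few vertices of a clique in X. *)
Fixpoint highs (h s : nat) (X : {set V}) : seq {set V} :=
  if s is s'.+1
  then high h s' X :: flatten [seq highs h s' (X :&: N x) | x <- enum V]
  else [::].

(* Containers: while C is rich, remove from it one of the sets [highs h s C];
   k bounds the number of rounds. *)
Fixpoint conts (h s k : nat) (C : {set V}) : seq {set V} :=
  if k is k'.+1 then
    if rich h s C then flatten [seq conts h s k' (C :\: D) | D <- highs h s C]
    else [:: C]
  else [:: C].

Lemma size_flatten_map_leq (T T' : eqType) (F : T -> seq T') (t : seq T) b :
  (forall x, size (F x) <= b) -> size (flatten [seq F x | x <- t]) <= size t * b.
Proof.
move=> Fb; elim: t => //= x t IH; rewrite size_cat mulSn; exact: leq_add.
Qed.

Lemma size_highs h s X : size (highs h s X) <= #|V|.+1 ^ s.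
Proof.
elim: s X => //= s IH X; rewrite expnS mulSn -add1n; apply: leq_add.
  by rewrite expn_gt0.
by apply: leq_trans (size_flatten_map_leq _ _) _ => //; rewrite -cardE.
Qed.

(** Each of the [k] rounds chooses one of at most [#|V|.+1 ^ s] sets to delete. *)
Lemma size_conts h s k C : size (conts h s k C) <= #|V|.+1 ^ (s * k).
Proof.
elim: k C => [|k IH] C; first by rewrite muln0.
rewrite /=; case: ifP => _; last by rewrite /= expn_gt0.
apply: leq_trans (size_flatten_map_leq _ (fun D => IH _)) _.
by rewrite mulnS expnD leq_mul2r size_highs orbT.
Qed.

(* Either S hardly meets the set of first vertices of many cliques of C, or some
   vertex of S in that set has a poor link in S and a rich link in C. *)
Lemma conts_step h h' s (C S : {set V}) : rich h s C -> ~~ rich h' s S ->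
  exists D, [/\ D \in highs h s C, h <= #|D|, D \subset C & #|S :&: D| < h'].
Proof.
elim: s C S => //= s IH C S hC; rewrite -ltnNge => hS.
case: (ltnP #|S :&: high h s C| h') => [lt|ge].
  exists (high h s C); split; rewrite ?inE ?eqxx //.
  by apply/subsetP => x; rewrite inE => /andP[].
have [x] : exists x, x \in (S :&: high h s C) :\: [set x in S | rich h' s (S :&: N x)].
  apply/set0Pn; rewrite setD_eq0; apply: contraTN ge => /subset_leq_card le.
  by rewrite -ltnNge; apply: leq_ltn_trans hS.
rewrite !inE => /andP[nr /andP[xS /andP[xC rC]]].
rewrite xS /= in nr.
have [D [Din hD DC cD]] := IH _ _ rC nr.
exists D; split => //.
- rewrite inE; apply/orP; right; apply/flattenP.
  by exists (highs h s (C :&: N x)) => //; apply/mapP; exists x; rewrite ?mem_enum.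
- by apply: subset_trans DC (subsetIl _ _).
- apply: leq_ltn_trans cD; apply: subset_leq_card; apply/subsetP => u.
  rewrite !inE => /andP[-> uD] /=; rewrite uD andbT.
  by move/subsetP/(_ u uD): DC; rewrite inE => /andP[].
Qed.

(** Each round deletes at least [h] vertices of the container, so [k] rounds exhaust it, and each
    round loses at most [h'.-1] elements of [S]. For [h' = 1] nothing is lost. *)
Lemma conts_cover h h' s k (C S : {set V}) : 0 < h -> #|C| <= h * k ->
  ~~ rich h' s S ->
  exists C', [/\ C' \in conts h s k C, C' \subset C, ~~ rich h s C' &
                 #|(S :&: C) :\: C'| <= k * h'.-1].
Proof.
move=> h0; elim: k C => [|k IH] C hC hS.
  have C0 : C = set0 by apply/eqP; rewrite -cards_eq0 -leqn0 -(muln0 h).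
  exists set0; rewrite C0 /= inE eqxx setI0 set0D cards0; split => //.
  (* Every set is rich at [s = 0], so [hS] excludes that case; otherwise [0 < h] makes the empty set
     poor. *)
  case: s hS => // s _ /=; rewrite -ltnNge.
  apply: leq_ltn_trans h0; rewrite leqn0 cards_eq0; apply/eqP/setP => x.
  by rewrite !inE.
rewrite /=; case: ifP => [rC|/negbT nr]; last first.
  by exists C; split; rewrite ?inE ?eqxx // setDE -setIA setICr setI0 cards0.
have [D [Din hD DC cD]] := conts_step rC hS.
have [|C' [C'in C'C nrC' cC']] := IH (C :\: D) _ hS.
  rewrite mulnS in hC; have := cardsD C D; rewrite (setIidPr DC); lia.
exists C'; split => //.
- by apply/flattenP; exists (conts h s k (C :\: D)) => //; apply/mapP; exists D.
- by apply: subset_trans C'C (subsetDl _ _).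
rewrite mulSn.
have sub : (S :&: C) :\: C' \subset (S :&: D) :|: ((S :&: (C :\: D)) :\: C').
  apply/subsetP => x; rewrite !inE => /andP[-> /andP[-> ->]] /=.
  by case: (x \in D).
apply: leq_trans (subset_leq_card sub) _.
apply: leq_trans (leq_card_setU _ _) _; apply: leq_add => //.
by rewrite -ltnS; apply: leq_trans cD _; rewrite leqSpred.
Qed.

(** Poverty survives sampling. By induction, a vertex of [W :&: X] whose link is rich after sampling
    already had a rich link in [X]; such vertices form a set of fewer than [h] elements, which [W]
    meets in fewer than [h']. *)
Lemma rich_setI h h' s (X W : {set V}) :
  (forall D, D \in highs h s X -> #|D| < h -> #|D :&: W| < h') ->
  ~~ rich h s X -> ~~ rich h' s (W :&: X).
Proof.
elim: s X => //= s IH X hW; rewrite -!ltnNge => hX.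
have := hW (high h s X); rewrite inE eqxx => /(_ isT hX).
apply: leq_ltn_trans; apply: subset_leq_card; apply/subsetP => x.
rewrite !inE => /andP[/andP[xW xX]]; rewrite xW xX /= andbT.
apply: contraLR; rewrite -setIA; apply: IH => D Din; apply: hW.
rewrite inE; apply/orP; right; apply/flattenP.
by exists (highs h s (X :&: N x)) => //; apply/mapP; exists x; rewrite ?mem_enum.
Qed.

Lemma rich1_clique s (X : {set V}) : (forall x, x \notin N x) ->
  (forall x y, (x \in N y) = (y \in N x)) -> rich 1 s X ->
  exists K : {set V}, [/\ K \subset X, #|K| = s &
    forall x y, x \in K -> y \in K -> x != y -> y \in N x].
Proof.
move=> irr sym; elim: s X => [|s IH] X.
  by exists set0; rewrite sub0set cards0; split => // x y; rewrite inE.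
rewrite /= card_gt0 => /set0Pn[x]; rewrite inE => /andP[xX /IH[K [KX cK Kcl]]].
have KN y : y \in K -> y \in N x by move/(subsetP KX); rewrite inE => /andP[].
exists (x |: K); split.
- rewrite subUset sub1set xX /=; exact: subset_trans KX (subsetIl _ _).
- rewrite cardsU1 cK; case: (boolP (x \in K)) => // /KN; by rewrite (negbTE (irr x)).
- move=> u v; rewrite !inE => /orP[/eqP->|uK] /orP[/eqP->|vK]; rewrite ?eqxx //.
  + by move=> _; apply: KN.
  + by move=> _; rewrite sym; apply: KN.
  + exact: Kcl.
Qed.

End Rich.

(** Richness of [X] sees only the graph induced on [X]. Hence poor sets and containers can be read
    off from an induced subgraph, before the remaining edges are chosen. *)
Lemma eq_rich (V : finType) (N N' : V -> {set V}) h s (X : {set V}) :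
  {in X, forall x, X :&: N x = X :&: N' x} -> rich N h s X = rich N' h s X.
Proof.
elim: s X => //= s IH X eqN; congr (_ <= _); apply: eq_card => x; rewrite !inE.
case: (boolP (x \in X)) => //= xX; rewrite -eqN //; apply: IH => y.
by rewrite inE => /andP[yX _]; rewrite -!setIA ![N x :&: _]setIC !setIA eqN.
Qed.

(** * Random sampling *)


(** Division-free form of the birthday bound: a random [w]-tuple from [a] elements is injective with
    probability at least [1 - w ^ 2 / a]. *)
Lemma ffact_lower a w : (a - w ^ 2) * a ^ w <= a * a ^_ w.
Proof.
elim: w => [|w IH]; first by rewrite expn0 ffactn0 subn0.
rewrite ffactnSr mulnA.
apply: leq_trans (leq_mul IH (leqnn (a - w))).
suff key : (a - w.+1 ^ 2) * a <= (a - w ^ 2) * (a - w).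
  have := leq_mul key (leqnn (a ^ w)); rewrite [a ^ w.+1]expnSr.
  by rewrite !mulnA ![_ * a ^ w]mulnC !mulnA.
case: (leqP (w.+1 ^ 2) a) => [le|lt]; last by rewrite (eqP (ltnW lt : _ - _ == 0)).
rewrite -(subnK le); move: (a - w.+1 ^2) => c; rewrite addnK.
have -> : c + w.+1 ^ 2 - w ^ 2 = c + (2 * w + 1) by rewrite -addn1 sqrnD; lia.
have -> : c + w.+1 ^ 2 - w = c + (w ^ 2 + w + 1) by rewrite -addn1 sqrnD; lia.
have -> : w.+1 ^ 2 = w ^ 2 + 2 * w + 1 by rewrite -addn1 sqrnD; lia.
rewrite !mulnDr !mulnDl; lia.
Qed.

Lemma ffact_half a w : 0 < a -> 2 * w ^ 2 <= a -> a ^ w <= 2 * a ^_ w.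
Proof.
move=> a0 h; rewrite -(leq_pmul2l a0).
have le : a <= 2 * (a - w ^ 2) by lia.
have := leq_mul le (leqnn (a ^ w)); have := ffact_lower a w; lia.
Qed.

Lemma leq_card_bigcup_seq (T I : finType) (r : seq I) (P : pred I) (F : I -> {set T}) :
  #|\bigcup_(i <- r | P i) F i| <= \sum_(i <- r | P i) #|F i|.
Proof.
elim/big_rec2: _ => [|i n A _ IH]; first by rewrite cards0.
by apply: leq_trans (leq_card_setU _ _) _; rewrite leq_add2l.
Qed.

Section Sampling.
Import Order.TTheory GRing.Theory Num.Theory.
Local Open Scope ring_scope.
Variable R : realType.

Lemma expR_ge2 : (2 : R) <= expR 1.
Proof. by have := expR_ge1Dx (1 : R); lra. Qed.

(* Exponential Markov inequality with weight x = 1 + 1/(2Y) per hit. *)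
Lemma tail_tuples (V : finType) (A H : {set V}) (w Y : nat) : (0 < Y)%N -> (0 < #|A|)%N ->
  #|[set t : {ffun 'I_w -> V} in ffun_on (mem A) |
      ((#|H :&: A| * Y + #|A|) * w < #|[set i | t i \in H]| * (#|A| * Y))%N]|%:R
    * expR (w%:R / (8 * Y%:R ^+ 2)) <= #|A|%:R ^+ w :> R.
Proof.
move=> Y0 A0; set c := #|H :&: A|; set a := #|A|; set B := [set t | _].
have Yp : (1 : R) <= Y%:R by rewrite ler1n.
have ap : (0 : R) < a%:R by rewrite ltr0n.
have ca : (c%:R : R) <= a%:R by rewrite ler_nat subset_leq_card ?subsetIr.
(* [mu] is a lower bound for the logarithm of the weight [x]; it follows from
   [1 - mu <= expR (- mu)]. *)
pose la : R := (2 * Y%:R)^-1; pose x := 1 + la; pose mu := la / (1 + la).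
have la0 : 0 < la by rewrite invr_gt0; lra.
have laY : la * Y%:R = 1 / 2 by rewrite /la; field; lra.
have la1 : la <= 1 by nra.
have muE : mu * (1 + la) = la by rewrite /mu; field; lra.
have mu0 : 0 < mu by rewrite divr_gt0 //; lra.
have x_ge : expR mu <= x.
  rewrite -lef_pV2 ?posrE ?expR_gt0 //; last by rewrite /x; lra.
  rewrite -expRN; apply: le_trans _ (expR_ge1Dx _).
  have -> : x^-1 = 1 - mu by rewrite /x /mu; field; lra.
  exact: lexx.
(* The generating function of the number of hits factorises over the [w] independent coordinates. *)
have tot : \sum_(t | (t : {ffun 'I_w -> V}) \in ffun_on (mem A)) x ^+ #|[set i | t i \in H]|
   = (\sum_(v in A) (if v \in H then x else 1)) ^+ w.
  rewrite -[in RHS](card_ord w) -prodr_const bigA_distr_big /=.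
  apply: eq_bigr => t _; rewrite -big_mkcond /= prodr_const.
  by congr (_ ^+ _); apply: eq_card => i; rewrite inE.
have sumE : \sum_(v in A) (if v \in H then x else 1) = a%:R + c%:R * la.
  rewrite (eq_bigr (fun v => 1 + (if v \in H then la else 0))); last first.
    by move=> v _; rewrite /x; case: ifP; rewrite ?addr0.
  rewrite big_split /= sumr_const -big_mkcondr /= sumr_const; congr (_ + _).
  rewrite mulr_natl; congr (_ *+ _); apply: eq_card => v; by rewrite inE andbC.
have step1 : #|B|%:R * expR (mu * (c%:R / a%:R + Y%:R^-1) * w%:R) <= (a%:R + c%:R * la) ^+ w.
  rewrite -sumE -tot mulr_natl -sumr_const.
  apply: le_trans (_ : \sum_(t in B) x ^+ #|[set i | t i \in H]| <= _); last first.
    rewrite [leRHS](bigID (fun t => t \in B)) /=.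
    rewrite (eq_bigl (fun t => (t \in ffun_on (mem A)) && (t \in B))); last first.
      by move=> t; rewrite inE; case: (t \in ffun_on _).
    rewrite lerDl; apply: sumr_ge0 => t _; apply: exprn_ge0; rewrite /x; lra.
  apply: ler_sum => t; rewrite inE => /andP[_].
  set n := #|[set i | t i \in H]| => tl.
  apply: le_trans (_ : expR mu ^+ n <= _); last first.
    by rewrite lerXn2r // ?nnegrE ?expR_ge0 // /x; lra.
  rewrite -expRM_natr ler_expR -mulrA; apply: ler_wpM2l (ltW mu0) _ _ _.
  have -> : c%:R / a%:R + Y%:R^-1 = (c * Y + a)%:R / (a * Y)%:R :> R.
    rewrite natrD !natrM; field; apply/andP; split; lra.
  rewrite mulrAC ler_pdivrMr; last by rewrite ltr0n muln_gt0 Y0 A0.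
  by rewrite -!natrM ler_nat ltnW.
have step2 : (a%:R + c%:R * la) ^+ w <= a%:R ^+ w * expR (c%:R / a%:R * la * w%:R).
  rewrite expRM_natr -exprMn; apply: lerXn2r; rewrite ?nnegrE.
  - by rewrite addr_ge0 ?mulr_ge0 // ?ler0n; lra.
  - by rewrite mulr_ge0 ?expR_ge0 ?ler0n.
  - have -> : a%:R + c%:R * la = a%:R * (1 + c%:R / a%:R * la) by field; lra.
    by rewrite ler_wpM2l ?ler0n ?expR_ge1Dx.
rewrite -(ler_pM2r (expR_gt0 (c%:R / a%:R * la * w%:R))).
apply: le_trans (le_trans step1 step2).
rewrite -[#|B|%:R * _ * _]mulrA -expRD; apply: ler_wpM2l (ler0n _ _) _ _ _; rewrite ler_expR.
set p : R := c%:R / a%:R.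
have p1 : p <= 1 by rewrite /p ler_pdivrMr // mul1r.
have p0 : 0 <= p by rewrite divr_ge0 ?ler0n.
rewrite [w%:R / _]mulrC -mulrDl; apply: ler_wpM2r (ler0n _ _) _ _ _.
have iY : Y%:R^-1 = 2 * la by rewrite /la; field; lra.
have -> : (8 * Y%:R ^+ 2)^-1 = la ^+ 2 / 2 by rewrite /la; field; lra.
(* The two exponents differ by [la ^ 2 * (2 - p) / (1 + la)], which is at least [la ^ 2 / 2] because
   [p <= 1] and [la <= 1]. *)
rewrite iY; nra.
Qed.

(** Each set of [Hs] is over-sampled by at most a fraction [2 ^ -(L + 2)] of the tuples, so a union
    bound leaves at most a quarter of the tuples bad. At least half are injective; the image of a
    good injective tuple is [W]. *)
Lemma sampling (V : finType) (A : {set V}) (Hs : seq {set V}) (w Y L : nat) :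
  (0 < Y)%N -> (0 < #|A|)%N -> (2 * w ^ 2 <= #|A|)%N -> (size Hs <= 2 ^ L)%N ->
  (8 * Y ^ 2 * (L + 2) <= w)%N ->
  exists W : {set V}, [/\ W \subset A, #|W| = w &
    forall H, H \in Hs -> (#|H :&: W| * (#|A| * Y) <= (#|H :&: A| * Y + #|A|) * w)%N].
Proof.
move=> Y0 A0 wA sH wL.
pose B H := [set t : {ffun 'I_w -> V} in ffun_on (mem A) |
      ((#|H :&: A| * Y + #|A|) * w < #|[set i | t i \in H]| * (#|A| * Y))%N].
pose I := [set t : {ffun 'I_w -> V} in ffun_on (mem A) | injectiveb t].
have cI : (#|A| ^ w <= 2 * #|I|)%N by rewrite card_inj_ffuns_on card_ord ffact_half.
have cB H : (#|B H| * 2 ^ (L + 2) <= #|A| ^ w)%N.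
  rewrite -(ler_nat R) natrM !natrX; apply: le_trans (tail_tuples H w Y0 A0).
  rewrite ler_wpM2l ?ler0n //.
  apply: le_trans (_ : expR 1 ^+ (L + 2) <= _).
    by rewrite lerXn2r ?nnegrE ?ler0n ?expR_ge0 ?expR_ge2.
  rewrite -expRM_natr mul1r ler_expR ler_pdivlMr; last first.
    by rewrite mulr_gt0 // exprn_gt0 // ltr0n.
  by rewrite -[8]/(8%:R) -natrX -!natrM ler_nat; lia.
have cU : (#|\bigcup_(H <- Hs) B H| * 4 <= #|A| ^ w)%N.
  have le : (#|\bigcup_(H <- Hs) B H| * 2 ^ (L + 2) <= size Hs * #|A| ^ w)%N.
    apply: leq_trans (leq_mul (leq_card_bigcup_seq _ _ _) (leqnn _)) _.
    rewrite big_distrl /=; apply: leq_trans (_ : \sum_(H <- Hs) #|A| ^ w <= _)%N.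
      by apply: leq_sum => H _; apply: cB.
    by rewrite big_const_seq count_predT iter_addn_0 mulnC.
  have l2 : (0 < 2 ^ L)%N by rewrite expn_gt0.
  have le2 := leq_trans le (leq_mul sH (leqnn _)).
  rewrite -(leq_pmul2r l2); move: le2; rewrite expnD; lia.
have : I :\: \bigcup_(H <- Hs) B H != set0.
  rewrite setD_eq0; apply/negP => /subset_leq_card le.
  have : (0 < #|A| ^ w)%N by rewrite expn_gt0 A0.
  lia.
case/set0Pn => t; rewrite !inE => /andP[nB /andP[tA /injectiveP inj]].
exists [set t i | i : 'I_w]; split.
- by apply/subsetP => _ /imsetP[i _ ->]; move/ffun_onP: tA.
- by rewrite card_imset // card_ord.
- move=> H HH; have : t \notin B H.
    apply: contra nB => tB; rewrite bigcup_seq; apply/bigcupP; by exists H.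
  rewrite inE negb_and => /orP[/negP[]|]; first by rewrite /in_mem /= in tA *.
  rewrite -leqNgt; congr (_ * _ <= _)%N.
  have -> : H :&: [set t i | i : 'I_w] = [set t i | i in [set i | t i \in H]].
    apply/setP => v; rewrite inE; apply/andP/imsetP.
      by case=> vH /imsetP[i _ vE]; exists i; rewrite // inE -vE.
    by case=> i; rewrite inE => iH ->; split => //; apply: imset_f.
  by rewrite card_imset.
Qed.
End Sampling.

(* (1 + 1/(2z))^z <= 2, by Bernoulli's inequality for (1 - 1/(2z+1))^i. *)
Lemma expn_succ_half z : (2 * z).+1 ^ z <= 2 * (2 * z) ^ z.
Proof.
have key i : i <= 2 * z -> (2 * z).+1 ^ i * ((2 * z).+1 - i) <= (2 * z) ^ i * (2 * z).+1.
  elim: i => [|i IH] lei; first by rewrite !expn0 subn0.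
  have {IH} := IH (ltnW lei); rewrite !expnS; set y := 2 * z in lei *.
  set p := _ ^ i; set q := y ^ i => IH.
  have le : y.+1 * (y.+1 - i.+1) <= y * (y.+1 - i) by rewrite subSS subSn; nia.
  have := leq_mul le (leqnn p); have := leq_mul (leqnn y) IH; lia.
have := key z; case: z {key} => [|z] // /(_ ltac:(lia)).
set p := _ ^ _; set q := (2 * z.+1) ^ _ => le.
have : p * (z.+2) <= q * (2 * z.+1).+1 by move: le; have -> : (2 * z.+1).+1 - z.+1 = z.+2 by lia.
move=> le2; have : p * z.+2 <= 2 * q * z.+2 by lia.
by rewrite leq_pmul2r.
Qed.


Lemma expn_succ_double z u : (2 * z).+1 ^ (2 * z * u) <= 2 ^ (2 * u) * (2 * z) ^ (2 * z * u).
Proof.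
have -> : 2 * z * u = z * (2 * u) by lia.
rewrite ![_ ^ (z * _)]expnM -expnMn.
case: (posnP (2 * u)) => [->|u0]; first by rewrite !expn0.
by rewrite leq_exp2r // expn_succ_half.
Qed.

(** The binomial theorem, by expanding a product over all of [V]: the factor is [1 + y] on [W] and
    [0 + 1] off [W], so only subsets of [W] contribute. *)
Lemma sum_subset_expn (V : finType) (W : {set V}) y :
  \sum_(T : {set V} | T \subset W) y ^ (#|W| - #|T|) = y.+1 ^ #|W|.
Proof.
pose F i := (i \in W) : nat; pose G i := if i \in W then y else 1.
have := @bigA_distr nat 0 1 muln addn V F G => /=.
rewrite (bigID (fun i => i \in W)) /= (eq_bigr (fun _ => y.+1)); last first.
  by move=> i iW; rewrite /F /G iW.
rewrite prod_nat_const (eq_bigr (fun _ => 1)) ?big1_eq ?muln1; last first.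
  by move=> i /negbTE iW; rewrite /F /G iW.
rewrite [in X in _ = X -> _](bigID (fun T : {set V} => T \subset W)) /= [X in _ + X]big1 ?addn0.
  move=> ->; apply: eq_bigr => T TW; rewrite (bigID (fun i => i \in T)) /=.
  rewrite (eq_bigr (fun _ => 1)) ?big1_eq ?mul1n; last first.
    by move=> i iT; rewrite iT /F (subsetP TW).
  rewrite (bigID (fun i => i \in W)) /= [X in _ * X]big1 ?muln1; last first.
    by move=> i /andP[/negbTE-> /negbTE iW]; rewrite /G iW.
  rewrite (eq_bigr (fun _ => y)); last by move=> i /andP[/negbTE-> iW]; rewrite /G iW.
  rewrite prod_nat_const; congr (_ ^ _); rewrite -[in LHS](setIidPr TW) -cardsD.
  by apply: eq_card => i; rewrite !inE.
move=> T /subsetPn[i iT iW]; rewrite (bigD1 i) //= iT /F (negbTE iW) mul0n //.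
Qed.


(** A Chernoff-type count: with weight [(2 * z) ^ (#|W| - #|T|)] each small [T] weighs at least
    [(2 * z) ^ (#|W| - j)], while the total [(2 * z).+1 ^ #|W|] exceeds [(2 * z) ^ #|W|] by at most
    the factor [2 ^ (2 * u)]. *)
Lemma card_small_subsets (V : finType) (W : {set V}) z u j :
  0 < z -> #|W| = 2 * z * u ->
  #|[set T : {set V} | (T \subset W) && (#|T| <= j)]| <= 2 ^ (2 * u) * (2 * z) ^ j.
Proof.
move=> z0 cW; set F := [set T | _].
have y0 k : 0 < (2 * z) ^ k by rewrite expn_gt0 muln_gt0 z0.
rewrite -(leq_pmul2r (y0 (#|W|))).
have le1 : #|F| * (2 * z) ^ #|W| <= (2 * z) ^ j * (2 * z).+1 ^ #|W|.
  rewrite -sum_subset_expn big_distrr -[#|F|]sum1_card big_distrl /=.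
  rewrite [X in _ <= X](bigID (fun T => T \in F)) /=.
  apply: leq_trans (leq_addr _ _).
  rewrite [X in _ <= X](eq_bigl (fun T => T \in F)); last first.
    by move=> T; rewrite inE; case: (T \subset W).
  apply: leq_sum => T; rewrite inE => /andP[TW cT].
  rewrite mul1n -expnD leq_pexp2l ?muln_gt0 ?z0 //.
  by have := subset_leq_card TW; lia.
have le2 := expn_succ_double z u; rewrite cW in le1 *.
have := leq_mul (leqnn ((2 * z) ^ j)) le2; move: le1.
set p := _.+1 ^ _; set q := _ ^ (2 * z * u); lia.
Qed.

(** A poor subset of [W] splits along its container [C] into an arbitrary subset of [C :&: W] and at
    most [j] leftover elements; these choices are multiplied by the number of containers. *)
Lemma card_nonrich (V : finType) (N : V -> {set V}) (W A : {set V}) h h' s k c j b :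
  W \subset A -> 0 < h -> #|A| <= h * k -> k * h'.-1 <= j ->
  (forall C, C \in conts N h s k A -> ~~ rich N h s C -> #|C :&: W| <= c) ->
  #|[set T : {set V} | (T \subset W) && (#|T| <= j)]| <= b ->
  #|[set S : {set V} | (S \subset W) && ~~ rich N h' s S]|
    <= #|V|.+1 ^ (s * k) * (2 ^ c * b).
Proof.
move=> WA h0 hk hj hc hb; set NR := [set S | _]; set sm := [set T | _] in hb.
pose good C := ~~ rich N h s C.
have sub : NR \subset \bigcup_(C <- conts N h s k A | good C)
    (fun p : {set V} * {set V} => p.1 :|: p.2) @: (setX (powerset (C :&: W)) sm).
  apply/subsetP => S; rewrite inE => /andP[SW nS].
  have [C [Cin CA nC cC]] := conts_cover h0 hk nS.
  rewrite big_mkcond bigcup_seq; apply/bigcupP; exists C => //; rewrite [good C]nC.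
  apply/imsetP; exists (S :&: C, S :\: C); last by rewrite /= setID.
  rewrite !inE /= setIC; apply/and3P; split.
  - by apply: setIS.
  - by apply: subset_trans SW; apply: subsetDl.
  - rewrite -(setIidPl (subset_trans SW WA)); exact: leq_trans cC hj.
apply: leq_trans (subset_leq_card sub) _.
apply: leq_trans (leq_card_bigcup_seq _ _ _) _.
apply: leq_trans (_ : \sum_(C <- conts N h s k A | good C) 2 ^ c * b <= _).
  rewrite [X in X <= _]big_seq_cond [X in _ <= X]big_seq_cond.
  apply: leq_sum => C /andP[Cin nC].
  apply: leq_trans (leq_imset_card _ _) _; rewrite cardsX card_powerset.
  by apply: leq_mul => //; rewrite leq_pexp2l // hc.
rewrite big_const_seq iter_addn_0 mulnC leq_mul2r; apply/orP; right.
by apply: leq_trans (count_size _ _) (size_conts _ _ _ _ _).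
Qed.

(** * Sampled sets with few poor subsets *)

Section SparseWitness.
Variable R : realType.
Variables (V : finType) (N : V -> {set V}).

Definition nonrich_sets h s (W : {set V}) : {set {set V}} :=
  [set S : {set V} | (S \subset W) && ~~ rich N h s S].

(** One sample [W] of [A] is made typical for two families. Typicality for the containers of [A],
    each smaller than [al], gives roughly [t = w * al / #|A|]. Typicality for the [highs] of the
    links gives a poor trace on [W] to all but about [h1] vertices of [A]. As [#|A|] exceeds [al] by
    [a], the product of [w - t] and the number of such vertices is about [w * a], and [Ga] is this
    minus the errors. *)
Lemma sparse_witness (A : {set V}) h h1 h' s k w v Y L a al b u Ga :
  0 < h -> #|V| <= h * k -> (forall C, ~~ rich N h s C -> #|C| < al) ->
  al + a <= #|A| -> ~~ rich N h1 s.+1 A ->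
  0 < Y -> 0 < #|A| -> 2 * w ^ 2 <= #|A| ->
  #|V|.+1 ^ (s * k) + #|V| * #|V|.+1 ^ s <= 2 ^ L -> 8 * Y ^ 2 * (L + 2) <= w ->
  w = Y * v -> (h1 * Y + #|A|) * w < h' * (#|A| * Y) ->
  w = 2 ^ b.+1 * u ->
  Ga + #|V| * (v + L + (2 * u + b.+1 * (k * h'))) + w * (h1 + w) <= w * a ->
  exists W : {set V}, #|W| = w /\ exists t, #|nonrich_sets h' s W| <= 2 ^ t /\
     Ga <= (w - t) * #|[set x in ~: W | N x :&: W \in nonrich_sets h' s W]|.
Proof.
move=> h0 hk hP hA nA Y0 A0 wA hL hw wv hh1 wu hGa.
pose Hs := conts N h s k A ++ flatten [seq highs N h1 s (A :&: N x) | x <- enum V].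
have sHs : size Hs <= 2 ^ L.
  apply: leq_trans hL; rewrite size_cat; apply: leq_add; first exact: size_conts.
  apply: leq_trans (size_flatten_map_leq _ (fun x => size_highs _ _ _ _)) _.
  by rewrite -cardE.
have [W [WA cW hW]] := sampling R Y0 A0 wA sHs hw.
have AV : #|A| <= #|V| by apply: max_card.
exists W; split=> //.
pose c := (al * Y + #|A|) * w %/ (#|A| * Y); pose j := k * h'.
(* The exponent pays for the part inside the container ([c]), the choice of the container ([L]) and
   the at most [j] elements outside it, counted with [z = 2 ^ b]. *)
exists (c + L + (2 * u + b.+1 * j)); split.
  have : #|[set T : {set V} | (T \subset W) && (#|T| <= j)]| <= 2 ^ (2 * u + b.+1 * j).
    rewrite expnD [2 ^ (b.+1 * _)]expnM expnS; apply: card_small_subsets; rewrite ?expn_gt0 //.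
    by rewrite cW wu expnS.
  move=> small.
  apply: leq_trans (@card_nonrich _ N W A h h' s k c j _ WA h0 _ _ _ small) _.
  - exact: leq_trans AV hk.
  - by rewrite leq_mul2l leq_pred orbT.
  - move=> C Cin nC; rewrite leq_divRL ?muln_gt0 ?A0 //.
    apply: leq_trans (hW C _) _; first by rewrite mem_cat Cin.
    rewrite leq_mul2r leq_add2r leq_mul2r; apply/orP; right; apply/orP; right.
    by apply: leq_trans (ltnW (hP C nC)); apply/subset_leq_card/subsetIl.
  - rewrite !expnD mulnCA mulnA leq_mul2r; apply/orP; right.
    by rewrite leq_mul2l; apply/orP; right; apply: leq_trans hL; apply: leq_addr.
have u0 : #|A| - h1 - w <= #|[set x in ~: W | N x :&: W \in nonrich_sets h' s W]|.
  pose U := [set x in A | ~~ rich N h1 s (A :&: N x)].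
  (* Since [A] is poor in [s.+1]-cliques, fewer than [h1] of its vertices have a rich link in
     [A]. *)
  have cU : #|A| - h1 <= #|U|.
    rewrite leq_subLR -(cardsID [set x | rich N h1 s (A :&: N x)] A).
    apply: leq_add.
      move: nA; rewrite /= -ltnNge => /ltnW; apply: leq_trans.
      by apply/subset_leq_card/subsetP => x; rewrite !inE.
    by apply/subset_leq_card/subsetP => x; rewrite !inE andbC.
  apply: leq_trans (_ : #|U :\: W| <= _).
    by have := cardsD U W; have := subset_leq_card (subsetIr U W); lia.
  apply/subset_leq_card/subsetP => x; rewrite !inE => /andP[-> /andP[xA nx]] /=.
  rewrite subsetIr /=.
  have -> : N x :&: W = W :&: (A :&: N x) by rewrite setIA (setIidPl WA) setIC.
  apply: rich_setI nx => D Din cD.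
  have /hW leD : D \in Hs.
    rewrite mem_cat; apply/orP; right; apply/flattenP.
    by exists (highs N h1 s (A :&: N x)) => //; apply/mapP; exists x; rewrite ?mem_enum.
  rewrite -(ltn_pmul2r (_ : 0 < #|A| * Y)) ?muln_gt0 ?A0 //.
  apply: leq_ltn_trans leD (leq_ltn_trans _ hh1).
  rewrite leq_mul2r leq_add2r leq_mul2r; apply/orP; right; apply/orP; right.
  by apply: leq_trans (ltnW cD); apply/subset_leq_card/subsetIl.
apply: leq_trans (leq_mul (leqnn _) u0).
(* Because [w = Y * v], the sampling error [#|A| * w / Y] is exactly [#|A| * v]. *)
have cA : c * #|A| <= al * w + #|A| * v.
  rewrite -(leq_pmul2r Y0) -mulnA; apply: leq_trans (leq_trunc_div _ _) _.
  by rewrite wv; lia.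
set t := c + L + _; set a0 := #|A| in hA cA AV *.
have tA : t * a0 <= al * w + #|V| * (v + L + (2 * u + b.+1 * j)).
  rewrite /t -addnA mulnDl.
  apply: leq_trans (leq_add cA (leq_mul (leqnn _) AV)) _.
  rewrite -addnA leq_add2l -[v + L + _]addnA mulnDr [(L + _) * _]mulnC leq_add2r.
  by rewrite leq_mul2r AV orbT.
have := leq_mul (leqnn w) hA; rewrite mulnDr => wA2.
rewrite -subnDA mulnBr mulnBl.
have : (w - t) * (h1 + w) <= w * (h1 + w) by rewrite leq_mul2r leq_subr orbT.
rewrite -/j in hGa; move: tA hGa wA2; rewrite [al * w]mulnC.
move: (#|V| * _) (w * (h1 + w)) ((w - t) * _) (t * a0) (w * a0) (w * al) (w * a).
by clear; lia.
Qed.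
End SparseWitness.

(** * Counting graphs by vertex deletion *)

Definition nbr n (E : {set {set 'I_n}}) (x : 'I_n) : {set 'I_n} := [set y | adj E x y].
Definition restr n (E : {set {set 'I_n}}) (W : {set 'I_n}) : {set {set 'I_n}} :=
  [set e in E | e \subset W].
Definition cross n (E : {set {set 'I_n}}) (W : {set 'I_n}) : {ffun 'I_n -> {set 'I_n}} :=
  [ffun x => if x \in ~: W then nbr E x :&: W else set0].

Lemma is_graphP n (E : {set {set 'I_n}}) e : is_graph E -> e \in E ->
  exists x y, x != y /\ e = [set x; y].
Proof. by move=> /forall_inP gE /gE /cards2P [x [y [xy ->]]]; exists x, y. Qed.

Lemma adjC n (E : {set {set 'I_n}}) x y : adj E x y = adj E y x.
Proof. by rewrite /adj setUC. Qed.

Lemma nbrC n (E : {set {set 'I_n}}) x y : (x \in nbr E y) = (y \in nbr E x).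
Proof. by rewrite !inE adjC. Qed.

Lemma nbr_irr n (E : {set {set 'I_n}}) x : is_graph E -> x \notin nbr E x.
Proof.
move=> /forall_inP gE; rewrite inE /adj setUid; apply/negP => /gE.
by rewrite cards1.
Qed.

Lemma nbr_restr n (E : {set {set 'I_n}}) (X : {set 'I_n}) x :
  x \in X -> nbr (restr E X) x = nbr E x :&: X.
Proof.
by move=> xX; apply/setP => y; rewrite !inE /adj inE subUset !sub1set xX /=.
Qed.

Lemma restr_graph n (E : {set {set 'I_n}}) X : is_graph E -> is_graph (restr E X).
Proof.
move=> /forall_inP gE; apply/forall_inP => e; rewrite inE => /andP[/gE]; by [].
Qed.

Lemma Kfree_sub k n (E E' : {set {set 'I_n}}) : E' \subset E -> Kfree k E -> Kfree k E'.
Proof.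
move=> sub; apply: contra => /existsP[K /andP[cK /forall_inP cl]].
apply/existsP; exists K; rewrite cK; apply/forall_inP => x xK; apply/forall_inP => y yK.
apply/implyP => xy; move/forall_inP: (cl x xK) => /(_ y yK) /implyP /(_ xy).
exact: (subsetP sub).
Qed.

Lemma restr_sub n (E : {set {set 'I_n}}) X : restr E X \subset E.
Proof. by apply/subsetP => e; rewrite inE => /andP[]. Qed.

Lemma graph_sub_ext n (E E' : {set {set 'I_n}}) (W : {set 'I_n}) :
  is_graph E -> restr E W = restr E' W -> restr E (~: W) = restr E' (~: W) ->
  cross E W = cross E' W -> E \subset E'.
Proof.
move=> gE rW rC cE; apply/subsetP => e eE.
have [x [y [xy eq_e]]] := is_graphP gE eE.
have crossE u v : u \in ~: W -> v \in W -> [set u; v] \in E -> [set u; v] \in E'.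
  move=> uW vW uv; have : v \in cross E W u by rewrite ffunE uW !inE vW andbT.
  by rewrite cE ffunE uW !inE => /andP[].
case: (boolP (x \in W)) => xW; case: (boolP (y \in W)) => yW.
- have : e \in restr E W by rewrite inE eE eq_e subUset !sub1set xW yW.
  by rewrite rW inE => /andP[].
- by rewrite eq_e setUC; apply: crossE; rewrite ?inE // setUC -eq_e.
- by rewrite eq_e; apply: crossE; rewrite ?inE // -eq_e.
- have : e \in restr E (~: W) by rewrite inE eE eq_e subUset !sub1set !inE xW yW.
  by rewrite rC inE => /andP[].
Qed.

Lemma graph_ext n (E E' : {set {set 'I_n}}) (W : {set 'I_n}) :
  is_graph E -> is_graph E' -> restr E W = restr E' W ->
  restr E (~: W) = restr E' (~: W) -> cross E W = cross E' W -> E = E'.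
Proof.
move=> gE gE' h1 h2 h3; apply/eqP; rewrite eqEsubset.
by rewrite (graph_sub_ext gE h1 h2 h3) (graph_sub_ext gE' (esym h1) (esym h2) (esym h3)).
Qed.

(** Relabelling [X] along [enum_val] pulls these graphs back injectively to graphs on [#|X|]
    vertices, and a clique of the pullback maps to a clique of the same size. *)
Lemma card_Kfree_within k n (X : {set 'I_n}) :
  #|[set E in Kfree_graphs k n | E \subset powerset X]| <= #|Kfree_graphs k #|X| |.
Proof.
pose ev : 'I_#|X| -> 'I_n := fun i => enum_val i.
have ev_inj : injective ev by apply: enum_val_inj.
pose pull (E : {set {set 'I_n}}) := [set e : {set 'I_#|X|} | ev @: e \in E].
have ev_im (e : {set 'I_n}) : e \subset X -> ev @: (ev @^-1: e) = e.
  move=> eX; apply/setP => x; apply/imsetP/idP.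
    by case=> i; rewrite inE => ie ->.
  move=> xe; have xX := subsetP eX x xe.
  by exists (enum_rank_in xX x); rewrite ?inE /ev enum_rankK_in.
rewrite -(card_in_imset (f := pull)).
  apply/subset_leq_card/subsetP => _ /imsetP[E + ->]; rewrite !inE.
  move=> /andP[/andP[/forall_inP gE kE] _]; apply/andP; split.
    by apply/forall_inP => e; rewrite inE => /gE; rewrite card_imset.
  apply: contra kE => /existsP[K /andP[cK /forall_inP cl]].
  apply/existsP; exists (ev @: K); rewrite card_imset // cK /=.
  apply/forall_inP => _ /imsetP[x xK ->]; apply/forall_inP => _ /imsetP[y yK ->].
  apply/implyP; rewrite (inj_eq ev_inj) => xy.
  move/forall_inP: (cl x xK) => /(_ y yK) /implyP /(_ xy).
  by rewrite /adj inE imsetU1 imset_set1.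
move=> E E'; rewrite !inE => /andP[_ /subsetP EX] /andP[_ /subsetP EX'] eqE.
apply/setP => e; apply/idP/idP => eE.
- have eX : e \subset X by have := EX e eE; rewrite inE.
  have : ev @^-1: e \in pull E by rewrite inE ev_im.
  by rewrite eqE inE ev_im.
- have eX : e \subset X by have := EX' e eE; rewrite inE.
  have : ev @^-1: e \in pull E' by rewrite inE ev_im.
  by rewrite -eqE inE ev_im.
Qed.

Lemma leq_card_bigcup_const (T I : finType) (A : {set I}) (F : I -> {set T}) b :
  (forall i, i \in A -> #|F i| <= b) -> #|\bigcup_(i in A) F i| <= #|A| * b.
Proof.
move=> Fb; apply: leq_trans (leq_card_bigcup_seq _ _ _) _.
by rewrite -sum_nat_const; apply: leq_sum.
Qed.

(** The counting device for both negligible classes: a graph is determined by [W], its restrictions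
    to [W] and to the complement, and the edges between them. The restriction to [W] is counted
    crudely by [2 ^ (k * k)]; only the crossing edges are counted carefully, and [Phi] may depend on
    both restrictions. *)
Lemma card_class n k q M (X : {set {set {set 'I_n}}})
  (Phi : {set 'I_n} -> {set {set 'I_n}} -> {set {set 'I_n}} ->
         {set {ffun 'I_n -> {set 'I_n}}}) :
  (forall E, E \in X -> E \in Kfree_graphs q n /\ exists W : {set 'I_n},
     #|W| = k /\ cross E W \in Phi W (restr E W) (restr E (~: W))) ->
  (forall (W : {set 'I_n}) H1 H2, #|W| = k -> #|Phi W H1 H2| <= M) ->
  #|X| <= 'C(n, k) * (2 ^ (k * k) * (#|Kfree_graphs q (n - k)| * M)).
Proof.
move=> XP PhiM.
pose B (W : {set 'I_n}) H1 H2 := [set E in X | [&& restr E W == H1, restr E (~: W) == H2 &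
   cross E W \in Phi W H1 H2]].
pose G1 (W : {set 'I_n}) := powerset [set e : {set 'I_n} | (e \subset W) && (#|e| == 2)].
pose G2 (W : {set 'I_n}) := [set E in Kfree_graphs q n | E \subset powerset (~: W)].
have sub : X \subset \bigcup_(W in [set W : {set 'I_n} | #|W| == k])
    \bigcup_(H1 in G1 W) \bigcup_(H2 in G2 W) B W H1 H2.
  apply/subsetP => E EX; have [EK [W [cW cE]]] := XP E EX.
  have [gE kE] : is_graph E /\ Kfree q E by move: EK; rewrite inE => /andP[].
  apply/bigcupP; exists W; first by rewrite inE cW.
  apply/bigcupP; exists (restr E W).
    rewrite inE; apply/subsetP => e; rewrite !inE => /andP[eE ->] /=.
    by move/forall_inP: gE; apply.
  apply/bigcupP; exists (restr E (~: W)).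
    rewrite !inE restr_graph // (Kfree_sub (restr_sub _ _) kE) /=.
    by apply/subsetP => e; rewrite !inE => /andP[].
  by rewrite inE EX !eqxx.
apply: leq_trans (subset_leq_card sub) _.
apply: leq_trans (leq_card_bigcup_const
  (b := 2 ^ (k * k) * (#|Kfree_graphs q (n - k)| * M)) _) _; last first.
  rewrite leq_mul2r; apply/orP; right.
  have -> : [set W : {set 'I_n} | #|W| == k] =
    [set W : {set 'I_n} | W \subset [set: 'I_n] & #|W| == k].
    by apply/setP => W; rewrite !inE subsetT.
  by rewrite cards_draws cardsT card_ord.
move=> W; rewrite inE => /eqP cW.
have cC : #|~: W| = n - k by rewrite cardsCs setCK card_ord cW.
apply: leq_trans (leq_card_bigcup_const (b := #|Kfree_graphs q (n - k)| * M) _) _; last first.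
  rewrite leq_mul2r; apply/orP; right; rewrite card_powerset leq_pexp2l //.
  rewrite cards_draws cW bin2 -divn2; apply: leq_trans (leq_div _ _) _.
  by rewrite leq_mul2l leq_pred orbT.
move=> H1 _.
apply: leq_trans (leq_card_bigcup_const (b := M) _) _; last first.
  by rewrite leq_mul2r -cC card_Kfree_within orbT.
move=> H2 _; apply: leq_trans (PhiM W H1 H2 cW).
rewrite -(card_in_imset (f := fun E => cross E W) (D := mem (B W H1 H2))).
  by apply/subset_leq_card/subsetP => _ /imsetP[E + ->]; rewrite inE => /and4P[].
move=> E E'; rewrite !inE => /and4P[EX /eqP r1 /eqP r2 _] /and4P[EX' /eqP r1' /eqP r2' _] cE.
have [+ _] := XP E EX; have [+ _] := XP E' EX'; rewrite !inE => /andP[g' _] /andP[g _].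
by apply: (graph_ext (W := W)) => //; rewrite ?r1 ?r2.
Qed.

(** * Growth of the number of r-partite graphs *)

Definition partite_graphs (r n : nat) : {set {set {set 'I_n}}} :=
  [set E | is_graph E && partite r E].

Section Extend.
Variable m : nat.
Let L : 'I_m -> 'I_m.+1 := lift ord_max.
Definition extend (p : {set {set 'I_m}} * {set 'I_m}) : {set {set 'I_m.+1}} :=
  [set L @: e | e : {set 'I_m} in p.1] :|: [set [set ord_max; L x] | x in p.2].

Let L_inj : injective L. Proof. exact: lift_inj. Qed.
Let L_max x : (L x == ord_max) = false. Proof. by rewrite eq_sym (negbTE (neq_lift _ _)). Qed.

Lemma extend_old (p : {set {set 'I_m}} * {set 'I_m}) (e : {set 'I_m}) :
  (L @: e \in extend p) = (e \in p.1).
Proof.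
rewrite inE; apply/orP/idP => [[/imsetP[e' e'E /(imset_inj L_inj)->] //|]|eE]; last first.
  by left; apply: imset_f.
case/imsetP => x _ eq_e; have : ord_max \in L @: e by rewrite eq_e !inE eqxx.
by case/imsetP => y _ /eqP; rewrite eq_sym L_max.
Qed.

Lemma extend_new (p : {set {set 'I_m}} * {set 'I_m}) x :
  ([set ord_max; L x] \in extend p) = (x \in p.2).
Proof.
rewrite inE; apply/orP/idP => [[/imsetP[e' _ eq_e]|/imsetP[y yS eq_e]]|xS]; last first.
- by right; apply/imsetP; exists x.
- have : L x \in [set ord_max; L y] by rewrite -eq_e !inE eqxx orbT.
  by rewrite !inE L_max /= => /eqP/L_inj->.
- have : ord_max \in L @: e' by rewrite -eq_e !inE eqxx.
  by case/imsetP => y _ /eqP; rewrite eq_sym L_max.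
Qed.

Lemma extend_inj : injective extend.
Proof.
move=> [E S] [E' S'] eqE; congr (_, _); apply/setP => x.
  by have := extend_old (E, S) x; rewrite eqE extend_old /= => ->.
by have := extend_new (E, S) x; rewrite eqE extend_new /= => ->.
Qed.

(** The new vertex takes the colour of a smallest class, which has at most [m %/ r] vertices by
    averaging, and may be joined to anything outside that class. *)
Lemma extend_partite r (E : {set {set 'I_m}}) : 0 < r -> E \in partite_graphs r m ->
  exists T : {set 'I_m}, m - m %/ r <= #|T| /\
    forall S : {set 'I_m}, S \subset T -> extend (E, S) \in partite_graphs r m.+1.
Proof.
move=> r0; rewrite inE => /andP[/forall_inP gE /existsP[f /forallP fE]].
have [i0 hi0] : exists i : 'I_r, #|[set x | f x == i]| <= m %/ r.
  apply/existsP; apply: contraT; rewrite negb_exists => /forallP all_big.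
  have tot : \sum_(i : 'I_r) #|[set x | f x == i]| = m.
    rewrite -[RHS](card_ord m) -sum1_card (partition_big f xpredT) //=.
    by apply: eq_bigr => i _; rewrite -sum1_card; apply: eq_bigl => x; rewrite inE.
  have : r * (m %/ r).+1 <= \sum_(i : 'I_r) #|[set x | f x == i]|.
    rewrite -[r in r * _]card_ord -sum_nat_const; apply: leq_sum => i _.
    by rewrite ltnNge.
  by rewrite tot leqNgt mulnC ltn_ceil.
exists (~: [set x | f x == i0]); split.
  by rewrite cardsCs setCK card_ord leq_sub2l.
move=> S ST; rewrite inE; apply/andP; split.
  apply/forall_inP => e; rewrite inE => /orP[/imsetP[e' /gE + ->]|/imsetP[x _ ->]].
    by rewrite card_imset.
  by rewrite cards2 [ord_max == _]eq_sym L_max.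
apply/existsP; exists [ffun x => if unlift ord_max x is Some y then f y else i0].
apply/forallP => i; apply/forall_inP => x; rewrite inE ffunE => xi.
apply/forall_inP => y; rewrite inE ffunE => yi; apply/negP => xy.
have aux a : [set ord_max; L a] \in extend (E, S) -> f a = i0 -> False.
  by rewrite extend_new /= => /(subsetP ST); rewrite !inE => /eqP.
case: (unliftP ord_max x) xi xy => [a ->|->] /eqP xi;
case: (unliftP ord_max y) yi => [b ->|->] /eqP yi; rewrite /adj.
- rewrite -/L -[[set L b]]imset_set1 -[[set L a]]imset_set1 -imsetU extend_old /= => ab.
  move/forall_inP: (fE i) => /(_ a); rewrite inE xi => /(_ (eqxx _)) /forall_inP /(_ b).
  by rewrite inE yi => /(_ (eqxx _)) /negP; apply.
- by rewrite setUC => /aux; apply; rewrite xi yi.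
- by move/aux; apply; rewrite xi yi.
- rewrite setUid inE => /orP[/imsetP[e _ eq_e]|/imsetP[z _ eq_e]].
    have : ord_max \in L @: e by rewrite -eq_e inE.
    by case/imsetP => z _ /eqP; rewrite eq_sym L_max.
  have : L z \in [set ord_max : 'I_m.+1] by rewrite eq_e !inE eqxx orbT.
  by rewrite inE L_max.
Qed.
End Extend.

Lemma partite_growth r m : 0 < r ->
  2 ^ (m - m %/ r) * #|partite_graphs r m| <= #|partite_graphs r m.+1|.
Proof.
move=> r0.
pose good (E : {set {set 'I_m}}) (T : {set 'I_m}) := (m - m %/ r <= #|T|) &&
  [forall S : {set 'I_m}, (S \subset T) ==> (extend (E, S) \in partite_graphs r m.+1)].
(* Fixing one admissible set for each graph turns the existence statement into a count of pairs
   [(E, S)], on which [extend] is injective. *)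
pose T E := odflt set0 [pick T | good E T].
have TP E : E \in partite_graphs r m -> good E (T E).
  move=> Eg; rewrite /T; case: pickP => //= no.
  have [T0 [cT hT]] := extend_partite r0 Eg.
  have := no T0; rewrite /good cT /= => /negP[].
  by apply/forallP => S; apply/implyP; apply: hT.
pose D := \bigcup_(E in partite_graphs r m) setX [set E] (powerset (T E)).
have -> : 2 ^ (m - m %/ r) * #|partite_graphs r m| =
   \sum_(E in partite_graphs r m) 2 ^ (m - m %/ r) by rewrite sum_nat_const mulnC.
apply: leq_trans (_ : \sum_(E in partite_graphs r m) 2 ^ #|T E| <= _).
  by apply: leq_sum => E /TP /andP[+ _]; apply: leq_pexp2l.
apply: leq_trans (_ : #|D| <= _).
  rewrite -sum1_card (eq_bigl (fun p : {set {set 'I_m}} * {set 'I_m} =>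
     (p.1 \in partite_graphs r m) && (p.2 \in powerset (T p.1)))); last first.
    move=> [E S]; apply/bigcupP/andP => [[E' E'g]|[Eg /= SE]].
      by rewrite inE /= => /andP[/set1P-> h]; split.
    by exists E => //; rewrite inE /= SE andbT; apply/set1P.
  rewrite -(pair_big_dep (fun E => E \in partite_graphs r m)
      (fun E S => S \in powerset (T E)) (fun _ _ => 1)) /=.
  by apply: leq_sum => E _; rewrite sum1_card card_powerset.
rewrite -(card_in_imset (f := @extend m) (D := mem D)); last first.
  by move=> x y _ _; apply: extend_inj.
apply/subset_leq_card/subsetP => G /imsetP[[E S] /bigcupP[E' E'g]].
rewrite inE /= => /andP[/set1P-> ]; rewrite inE => ST ->.
by have /andP[_ /forallP /(_ S) /implyP /(_ ST)] := TP _ E'g.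
Qed.

(** At every intermediate step the smallest class has at most [(m + k) %/ r] vertices, so one
    exponent serves for all [k] steps. *)
Lemma partite_growth_iter r m k : 0 < r ->
  2 ^ (k * (m - (m + k) %/ r)) * #|partite_graphs r m| <= #|partite_graphs r (m + k)|.
Proof.
move=> r0; elim: k => [|k IH]; first by rewrite mul0n mul1n addn0.
rewrite addnS; apply: leq_trans (partite_growth _ r0).
have le : m - (m + k).+1 %/ r <= m + k - (m + k) %/ r.
  by have := leq_div2r r (leqnSn (m + k)); lia.
apply: leq_trans (leq_mul (leqnn _) IH).
rewrite mulSn expnD -mulnA; apply: leq_mul; first by rewrite leq_pexp2l.
rewrite leq_mul2r leq_pexp2l ?orbT // leq_mul2l; apply/orP; right.
by have := leq_div2r r (leqnSn (m + k)); lia.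
Qed.

(** * Rigidity *)

(** Adding the sets one at a time, each new one meets the union of the earlier ones in at most [q]
    elements per earlier set. *)
Lemma sum_card_overlap (T I : finType) (B : I -> {set T}) (K : {set I}) q :
  (forall x y, x \in K -> y \in K -> x != y -> #|B x :&: B y| <= q) ->
  \sum_(x in K) #|B x| <= #|T| + #|K| ^ 2 * q.
Proof.
move=> Bq; rewrite -big_enum /=.
suff: forall s : seq I, uniq s -> {subset s <= K} ->
   \sum_(x <- s) #|B x| <= #|\bigcup_(x <- s) B x| + size s ^ 2 * q.
  move=> /(_ (enum K) (enum_uniq _)) h; rewrite [#|K|]cardE.
  apply: leq_trans (h _) _; first by move=> x; rewrite mem_enum.
  by rewrite leq_add2r max_card.
elim=> [|x s IH] /=; first by rewrite !big_nil.
case/andP=> xs us sK; rewrite !big_cons.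
have {}IH := IH us (fun y ys => sK y (mem_behead (s := x :: s) ys)).
set U := \bigcup_(x <- s) B x in IH *.
have le : #|B x :&: U| <= size s * q.
  rewrite /U big_distrr /=; apply: leq_trans (leq_card_bigcup_seq _ _ _) _.
  apply: leq_trans (_ : \sum_(y <- s) q <= _).
    rewrite big_seq [X in _ <= X]big_seq; apply: leq_sum => y ys; apply: Bq.
    - by apply: sK; rewrite inE eqxx.
    - by apply: sK; rewrite inE ys orbT.
    - by apply: contraNneq xs => ->.
  by rewrite big_const_seq count_predT iter_addn_0 mulnC.
have -> : (size s).+1 ^ 2 * q = size s ^ 2 * q + size s * q + size s * q + q.
  by rewrite -addn1 sqrnD; lia.
have := cardsUI (B x) U; lia.
Qed.

Lemma subset_of_card (T : finType) (A : {set T}) k : k <= #|A| ->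
  exists B : {set T}, B \subset A /\ #|B| = k.
Proof.
move=> kA; have := cards_draws A k; set D := [set _ | _] => cD.
have : 0 < #|D| by rewrite cD bin_gt0.
by rewrite card_gt0 => /set0Pn[B]; rewrite inE => /andP[BA /eqP cB]; exists B.
Qed.

Lemma superset_of_card (T : finType) (A : {set T}) k : #|A| <= k -> k <= #|T| ->
  exists B : {set T}, A \subset B /\ #|B| = k.
Proof.
move=> Ak kT; have [|B [BA cB]] := @subset_of_card _ (~: A) (k - #|A|).
  by have := cardsC A; lia.
exists (A :|: B); rewrite subsetUl cardsU cB; split => //.
have -> : A :&: B = set0.
  by apply/eqP; rewrite setI_eq0 disjoint_sym; rewrite disjoints_subset.
by rewrite cards0 subn0 subnKC.
Qed.

Lemma partite_of_equiv n (E : {set {set 'I_n}}) r (e : rel 'I_n) :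
  equivalence_rel e -> (forall x y, adj E x y -> ~~ e x y) ->
  (forall K : {set 'I_n}, #|K| = r.+1 ->
     exists x y, [/\ x \in K, y \in K, x != y & e x y]) ->
  partite r E.
Proof.
move=> /equivalence_relP [re le] adjE few.
(* The result of [pick] depends only on the extension of the predicate, so equivalent vertices
   receive the same representative. *)
pose rep x := odflt x [pick z | e z x].
have sym x y : e x y = e y x.
  by apply/idP/idP => h; rewrite -(le _ _ h) re.
have rep_e x : e (rep x) x by rewrite /rep; case: pickP => //= _; apply: re.
have rep_eq x y : e x y -> rep x = rep y.
  move=> xy; rewrite /rep (eq_pick (Q := fun z => e z y)); last first.
    by move=> z; rewrite sym (le _ _ xy) sym.
  by case: pickP => //= /(_ x); rewrite xy.
pose S := [set rep x | x : 'I_n].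
have cS : #|S| <= r.
  rewrite leqNgt; apply/negP => rS.
  have [K [KS cK]] := subset_of_card rS.
  have [x [y [xK yK xy exy]]] := few K cK.
  case/negP: xy; case/imsetP: (subsetP KS x xK) exy => a _ ->.
  case/imsetP: (subsetP KS y yK) => b _ -> exy; apply/eqP/rep_eq.
  by rewrite -(le _ _ (rep_e a)) (le _ _ exy) rep_e.
have col x : index (rep x) (enum S) < r.
  by apply: leq_trans cS; rewrite cardE index_mem mem_enum imset_f.
apply/existsP; exists [ffun x => Ordinal (col x)].
apply/forallP => i; apply/forall_inP => x; rewrite inE ffunE => /eqP xi.
apply/forall_inP => y; rewrite inE ffunE => /eqP; rewrite -xi => /(congr1 val) /= yx.
apply/negP => /adjE /negP; apply.
have rxy : rep x = rep y.
  by apply/esym; apply: (index_inj x (s := enum S)) => //; rewrite mem_enum imset_f.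
by rewrite -(le _ _ (rep_e x)) rxy rep_e.
Qed.

(** In an [s.+1]-partite graph an [s]-clique uses all colours but one, so two vertices joined to the
    same [s]-clique have the same colour. This relation is the candidate for lying in the same
    part. *)
Definition shares_clique n (E : {set {set 'I_n}}) s (x y : 'I_n) : bool :=
  rich (nbr E) 1 s (nbr E x :&: nbr E y).

Lemma shares_cliqueC n (E : {set {set 'I_n}}) s x y :
  shares_clique E s x y = shares_clique E s y x.
Proof. by rewrite /shares_clique setIC. Qed.

Lemma Kfree_rich n (E : {set {set 'I_n}}) s X : is_graph E -> Kfree s E ->
  ~~ rich (nbr E) 1 s X.
Proof.
move=> gE; apply: contra => /(rich1_clique (fun x => nbr_irr x gE) (nbrC E)).
case=> K [_ cK cl]; apply/existsP; exists K; rewrite cK eqxx /=.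
apply/forall_inP => x xK; apply/forall_inP => y yK; apply/implyP => xy.
by have := cl x y xK yK xy; rewrite inE.
Qed.

Lemma Kfree_nbr n (E : {set {set 'I_n}}) s x : is_graph E -> Kfree s.+1 E ->
  ~~ rich (nbr E) 1 s (nbr E x).
Proof.
move=> gE kE; have := Kfree_rich setT gE kE; rewrite /= -ltnNge ltnS leqn0 cards_eq0.
by move=> /eqP/setP/(_ x); rewrite inE in_setT setTI in_set0 /= => ->.
Qed.

Lemma adj_not_shares n (E : {set {set 'I_n}}) s x y : is_graph E -> Kfree s.+2 E ->
  adj E x y -> ~~ shares_clique E s x y.
Proof.
move=> gE kE xy; have := Kfree_nbr x gE kE; rewrite /= -ltnNge ltnS leqn0 cards_eq0.
by move=> /eqP/setP/(_ y); rewrite /shares_clique !inE xy /= => ->.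
Qed.

(** If [u] and [v] share an [s]-clique [F], the sets [B f] for [f] in [F] are almost disjoint from
    each other and from [B u :|: B v], which leaves so little room that [B u] and [B v] nearly
    coincide. Hence the relation is transitive on distinct vertices (second numerical hypothesis).
    The first one forbids [s + 2] pairwise inequivalent vertices, whose sets would not fit into the
    vertex set. *)
Lemma rigid_partite n (E : {set {set 'I_n}}) s be q :
  is_graph E -> Kfree s.+2 E ->
  (forall K : {set 'I_n}, #|K| <= 2 * s + 3 -> exists B : 'I_n -> {set 'I_n},
     (forall x, x \in K -> be <= #|B x|) /\
     (forall x y, x \in K -> y \in K -> x != y -> ~~ shares_clique E s x y ->
        #|B x :&: B y| <= q)) ->
  n + (s + 2) ^ 2 * q < (s + 2) * be ->
  3 * n + (6 * (s + 1) ^ 2 + 1) * q < (3 * s + 4) * be ->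
  partite s.+1 E.
Proof.
move=> gE kE loc num1 num2.
have noadj x y : adj E x y -> ~~ shares_clique E s x y by apply: adj_not_shares.
have clq x y : shares_clique E s x y -> exists F : {set 'I_n},
   [/\ F \subset nbr E x :&: nbr E y, #|F| = s &
     forall a b, a \in F -> b \in F -> a != b -> adj E a b].
  move=> /(rich1_clique (fun x => nbr_irr x gE) (nbrC E)) [F [h1 h2 h3]].
  by exists F; split => // a b aF bF ab; have := h3 a b aF bF ab; rewrite inE.
have pair_bound u v (F K : {set 'I_n}) (B : 'I_n -> {set 'I_n}) :
   F \subset nbr E u :&: nbr E v -> #|F| = s ->
   (forall a b, a \in F -> b \in F -> a != b -> adj E a b) ->
   (forall x, x \in K -> be <= #|B x|) ->
   (forall x y, x \in K -> y \in K -> x != y -> ~~ shares_clique E s x y ->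
        #|B x :&: B y| <= q) -> F \subset K -> u \in K -> v \in K ->
   s * be + #|B u :|: B v| <= n + 2 * (s + 1) ^ 2 * q.
  move=> FN cF cl Bbe Bq FK uK vK.
  (* Merging [B v] into [B u] gives [s + 1] nearly disjoint sets indexed by [u |: F]; the merged set
     doubles the permitted overlap. *)
  pose B1 x := if x == u then B u :|: B v else B x.
  have FNu f : f \in F -> adj E u f /\ adj E v f.
    by move/(subsetP FN); rewrite !inE => /andP[].
  have uF : u \notin F by apply/negP => /FNu[]; have := nbr_irr u gE; rewrite inE => /negbTE->.
  have vF : v \notin F by apply/negP => /FNu[_]; have := nbr_irr v gE; rewrite inE => /negbTE->.
  have uvf f : f \in F -> #|(B u :|: B v) :&: B f| <= 2 * q.
    move=> fF; have [uf vf] := FNu f fF; have fK := subsetP FK f fF.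
    rewrite setIUl; apply: leq_trans (leq_card_setU _ _) _.
    have := Bq u f uK fK; have := Bq v f vK fK.
    move=> /(_ (contraNneq (fun e => eq_ind_r (fun z => is_true (z \in F)) fF e) vF)).
    move=> /(_ (noadj _ _ vf)) le1.
    move=> /(_ (contraNneq (fun e => eq_ind_r (fun z => is_true (z \in F)) fF e) uF)).
    by move=> /(_ (noadj _ _ uf)) le2; rewrite mul2n -addnn; apply: leq_add.
  have ov : forall x y, x \in u |: F -> y \in u |: F -> x != y -> #|B1 x :&: B1 y| <= 2 * q.
    move=> x y; rewrite !inE /B1.
    case: (eqVneq x u) => [->|xu] /=; case: (eqVneq y u) => [->|yu] //=.
    - by move=> _ yF _; apply: uvf.
    - by move=> xF _ _; rewrite setIC; exact: uvf.
    - move=> xF yF xy; apply: leq_trans (Bq x y _ _ xy (noadj _ _ (cl _ _ xF yF xy))) _.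
      + exact: (subsetP FK).
      + exact: (subsetP FK).
      + by rewrite leq_pmull.
  have := sum_card_overlap ov; rewrite card_ord cardsU1 uF cF.
  rewrite big_setU1 //= {1}/B1 eqxx.
  have : s * be <= \sum_(x in F) #|B1 x|.
    rewrite -cF -sum_nat_const; apply: leq_sum => x xF; rewrite /B1 ifN.
      exact/Bbe/(subsetP FK).
    by apply: contraNneq uF => <-.
  rewrite addnC [1 + s]addnC [_ * (2 * q)]mulnCA mulnA => h1.
  by apply: leq_trans; rewrite leq_add2r; exact: h1.
pose e x y := (x == y) || shares_clique E s x y.
have trans u v w : e u v -> e v w -> e u w.
  rewrite /e; case: (eqVneq u v) => [->|uv] //=; case: (eqVneq v w) => [<-|vw] //=.
    by move=> ->; rewrite orbT.
  case: (eqVneq u w) => //= uw suv svw; apply: contraT => nuw.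
  have [F [FN cF Fcl]] := clq _ _ suv; have [F' [FN' cF' Fcl']] := clq _ _ svw.
  pose K := [set u; v; w] :|: (F :|: F').
  have cK : #|K| <= 2 * s + 3.
    apply: leq_trans (leq_card_setU _ _) _.
    have := leq_card_setU F F'; rewrite cF cF'.
    have : #|[set u; v; w]| <= 3.
      by apply: leq_trans (leq_card_setU _ _) _; rewrite cards1 cards2; case: (u != v).
    move=> h3 hF; apply: leq_trans (leq_add h3 hF) _; clear; lia.
  have [B [Bbe Bq]] := loc K cK.
  have uK : u \in K by rewrite !inE eqxx.
  have vK : v \in K by rewrite !inE eqxx ?orbT.
  have wK : w \in K by rewrite !inE eqxx ?orbT.
  have FK : F \subset K by rewrite /K setUCA subsetUl.
  have FK' : F' \subset K by rewrite /K setUA subsetUr.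
  have b1 := pair_bound _ _ _ _ _ FN cF Fcl Bbe Bq FK uK vK.
  have b2 := pair_bound _ _ _ _ _ FN' cF' Fcl' Bbe Bq FK' vK wK.
  have b3 := Bq u w uK wK uw nuw.
  have b4 := Bbe u uK; have b5 := Bbe w wK; have b6 := Bbe v vK.
  (* Inside [B v], the sets [B u :&: B v] and [B v :&: B w] are both so large that they meet in more
     than [q] elements, all lying in [B u :&: B w]; this contradicts [b3]. *)
  have c1 := cardsUI (B u) (B v); have c2 := cardsUI (B v) (B w).
  have c3 := cardsUI (B u :&: B v) (B v :&: B w).
  have c4 : #|(B u :&: B v) :|: (B v :&: B w)| <= #|B v|.
    by apply/subset_leq_card; rewrite subUset subsetIr subsetIl.
  have c5 : #|(B u :&: B v) :&: (B v :&: B w)| <= #|B u :&: B w|.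
    by apply/subset_leq_card/setISS; [apply: subsetIl|apply: subsetIr].
  have c6 : #|B v| <= #|B u :|: B v| by apply/subset_leq_card/subsetUr.
  move: num2 b1 b2; rewrite !mulnDl.
  move: (s * be) ((s + 1) ^ 2 * q) => sb s2q.
  move: b3 b4 b5 b6 c1 c2 c3 c4 c5 c6; clear; lia.
apply: (@partite_of_equiv _ _ _ e).
- apply/equivalence_relP; split; first by move=> x; rewrite /e eqxx.
  have sym x y : e x y = e y x by rewrite /e eq_sym shares_cliqueC.
  move=> x y xy z; apply/idP/idP; last exact: trans.
  by apply: trans; rewrite sym.
- move=> x y xy; rewrite /e negb_or noadj // andbT.
  by apply: contraTneq xy => ->; have := nbr_irr y gE; rewrite inE.
- move=> K cK; case: (boolP [exists x in K, exists y in K, (x != y) && e x y]).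
    by move=> /exists_inP[x xK /exists_inP[y yK /andP[xy exy]]]; exists x, y.
  move=> none; exfalso.
  have [|B [Bbe Bq]] := loc K; first by rewrite cK; lia.
  have ov x y : x \in K -> y \in K -> x != y -> #|B x :&: B y| <= q.
    move=> xK yK xy; apply: Bq => //; apply: contra none => sxy.
    by apply/exists_inP; exists x => //; apply/exists_inP; exists y; rewrite // xy /e sxy orbT.
  have := sum_card_overlap ov; rewrite card_ord cK.
  have : s.+2 * be <= \sum_(x in K) #|B x|.
    by rewrite -cK -sum_nat_const; apply: leq_sum.
  move: num1; rewrite addn2; clear; lia.
Qed.

(** * The two negligible classes *)

Lemma leq_expn_base k a b : a <= b -> a ^ k <= b ^ k.
Proof. by case: k => // k ab; rewrite leq_exp2r. Qed.

Lemma card_pfamily_prod (aT rT : finType) (y0 : rT) (D : {set aT}) (F : aT -> {set rT}) :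
  #|pfamily y0 (mem D) (fun x => mem (F x))| = \prod_(x in D) #|F x|.
Proof. by rewrite card_pfamily foldrE big_map big_enum. Qed.

Lemma eq_rich_restr n (E : {set {set 'I_n}}) (X Y : {set 'I_n}) h s : Y \subset X ->
  rich (nbr (restr E X)) h s Y = rich (nbr E) h s Y.
Proof.
move=> YX; apply: eq_rich => x xY; rewrite nbr_restr ?(subsetP YX) //.
by rewrite [nbr E x :&: X]setIC setIA (setIidPl YX).
Qed.

Lemma nonrich_sets_restr n (E : {set {set 'I_n}}) (W : {set 'I_n}) h s :
  nonrich_sets (nbr (restr E W)) h s W = nonrich_sets (nbr E) h s W.
Proof.
apply/setP => S; rewrite !inE; case: (boolP (S \subset W)) => //= SW.
by rewrite eq_rich_restr.
Qed.

(* Class (1): a w-set W with few subsets poor in s-cliques, which are the traces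
   on W of the neighbourhoods of many vertices; Ga is the gain in the exponent. *)
Definition sparse_cut n (E : {set {set 'I_n}}) h s w Ga : Prop :=
  exists W : {set 'I_n}, #|W| = w /\ exists t,
    #|nonrich_sets (nbr E) h s W| <= 2 ^ t /\
    Ga <= (w - t) * #|[set x in ~: W | nbr E x :&: W \in nonrich_sets (nbr E) h s W]|.

(** Once the restriction to [W] is known, so is the list of poor traces. After guessing the set [U]
    of vertices with poor trace ([2 ^ n] ways), each vertex of [U] has at most [2 ^ t] traces
    instead of [2 ^ w], which saves [(w - t) * #|U|] in the exponent. *)
Lemma card_sparse_cut n q h s w Ga (X : {set {set {set 'I_n}}}) :
  (forall E, E \in X -> E \in Kfree_graphs q n /\ sparse_cut E h s w Ga) ->
  #|X| <= 'C(n, w) * (2 ^ (w * w) *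
            (#|Kfree_graphs q (n - w)| * (2 ^ n * 2 ^ (w * (n - w) - Ga)))).
Proof.
move=> XP.
pose NR (W : {set 'I_n}) H := nonrich_sets (nbr H) h s W.
pose F (W : {set 'I_n}) H (U : {set 'I_n}) x := if x \in U then NR W H else powerset W.
pose ok (W : {set 'I_n}) H (U : {set 'I_n}) :=
  \prod_(x in ~: W) #|F W H U x| <= 2 ^ (w * (n - w) - Ga).
pose Phi (W : {set 'I_n}) (H H' : {set {set 'I_n}}) :=
  \bigcup_(U in [set U : {set 'I_n} | ok W H U])
    [set g in pfamily set0 (mem (~: W)) (fun x => mem (F W H U x))].
apply: (card_class (Phi := Phi)) => [E /XP[EK [W [cW [t [ht hGa]]]]]|W H1 H2 cW].
  split=> //; exists W; split=> //.
  set H := restr E W; set U := [set x in ~: W | _] in hGa.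
  have NRE : NR W H = nonrich_sets (nbr E) h s W by apply: nonrich_sets_restr.
  apply/bigcupP; exists U; last first.
    rewrite inE; apply/pfamilyP; split.
      by apply/supportP => x xW; rewrite ffunE (negbTE xW).
    move=> x xW; rewrite ffunE xW /F NRE; case: ifP; last by rewrite powersetE subsetIr.
    by rewrite inE => /andP[].
  rewrite inE /ok.
  have UW : U \subset ~: W by apply/subsetP => x; rewrite inE => /andP[].
  rewrite (bigID (fun x => x \in U)) /=.
  rewrite (eq_bigr (fun _ => #|NR W H|)); last by move=> x /andP[_ xU]; rewrite /F xU.
  rewrite [X in _ * X](eq_bigr (fun _ => 2 ^ w)); last first.
    by move=> x /andP[_ /negbTE xU]; rewrite /F xU card_powerset cW.
  rewrite !prod_nat_const -expnM NRE.
  have -> : #|[pred x | (x \in ~: W) && (x \in U)]| = #|U|.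
    by apply: eq_card => x; rewrite inE andb_idl // => /(subsetP UW).
  have -> : #|[pred x | (x \in ~: W) && (x \notin U)]| = n - w - #|U|.
    transitivity #|~: W :\: U|; first by apply: eq_card => x; rewrite !inE andbC.
    by rewrite cardsD (setIidPr UW) [#|~: W|]cardsCs setCK card_ord cW.
  have cU : #|U| <= n - w.
    have := subset_leq_card UW; by rewrite [#|~: W|]cardsCs setCK card_ord cW.
  (* Replacing [t] by the minimum of [t] and [w] makes the truncated subtraction [w - t] exact. *)
  have [m [hm1 hm2 hm3]] : exists m, [/\ m <= w, #|nonrich_sets (nbr E) h s W| <= 2 ^ m &
      Ga <= (w - m) * #|U|].
    case: (leqP t w) => tw; first by exists t.
    exists w; split => //.
      rewrite -cW -card_powerset; apply/subset_leq_card/subsetP => S.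
      by rewrite !inE => /andP[].
    by apply: leq_trans hGa _; rewrite (eqP (ltnW tw : w - t == 0)).
  apply: leq_trans (leq_mul (leq_expn_base #|U| hm2) (leqnn _)) _.
  rewrite -expnM -expnD leq_pexp2l //.
  have := leq_mul (leqnn w) cU; have := leq_mul hm1 (leqnn #|U|).
  move: hm3; rewrite mulnBl mulnBr; clear; lia.
apply: leq_trans (leq_card_bigcup_const (b := 2 ^ (w * (n - w) - Ga)) _) _.
  by move=> U; rewrite inE /ok => okU; rewrite cardsE card_pfamily_prod.
rewrite leq_mul2r; apply/orP; right.
rewrite -[n in 2 ^ n]card_ord -cardsT -card_powerset.
by apply/subset_leq_card/subsetP => U _; rewrite powersetE subsetT.
Qed.

(** Adding [x] and [y] to the subsets of [T :\ x :\ y] shows that at least a quarter of the subsets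
    of [T] contain both. *)
Lemma card_avoid_pair (I : finType) (T : {set I}) x y : x \in T -> y \in T -> x != y ->
  4 * #|[set S in powerset T | ~~ ((x \in S) && (y \in S))]| <= 3 * 2 ^ #|T|.
Proof.
move=> xT yT xy; set A := [set S in _ | _].
pose G := [set S in powerset T | (x \in S) && (y \in S)].
have tot : #|A| + #|G| = 2 ^ #|T|.
  rewrite -card_powerset -(cardsID G (powerset T)) addnC; congr (_ + _); apply: eq_card => S.
    by rewrite !inE; case: (S \subset T).
  by rewrite !inE; case: (S \subset T); rewrite ?andbF ?andbT.
have cG : 2 ^ #|T| <= 4 * #|G|.
  have cT : #|T| = #|T :\ x :\ y|.+2.
    by rewrite (cardsD1 x) xT (cardsD1 y (T :\ x)) !inE eq_sym xy yT.
  rewrite cT !expnS mulnA leq_mul2l /= -card_powerset.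
  have inj : {in powerset (T :\ x :\ y) &, injective (fun S : {set I} => x |: (y |: S))}.
    move=> S S'; rewrite !powersetE !subsetD1 => /andP[/andP[_ xS] yS] /andP[/andP[_ xS'] yS'] eqS.
    apply/setP => z; move/setP/(_ z): eqS; rewrite !inE.
    case: (eqVneq z x) => [->|_] /=; first by rewrite (negbTE xS) (negbTE xS').
    by case: (eqVneq z y) => [->|_] /=; first by rewrite (negbTE yS) (negbTE yS').
  rewrite -(card_in_imset inj); apply/subset_leq_card/subsetP => _ /imsetP[S + ->].
  rewrite !inE !eqxx ?orbT !andbT => ST.
  rewrite !subUset !sub1set xT yT (subset_trans ST) //.
  exact: subset_trans (subsetDl _ _) (subsetDl _ _).
by move: tot cG; clear; lia.
Qed.

Lemma expn_three_quarters k : 3 ^ k * 2 ^ (k %/ 3) <= 4 ^ k.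
Proof.
rewrite {1 3}(divn_eq k 3); move: (k %/ 3) (k %% 3) => a b.
rewrite !expnD mulnAC; apply: leq_mul; last exact: leq_expn_base.
by rewrite mulnC [a * 3]mulnC !expnM -expnMn; apply: leq_expn_base.
Qed.

Lemma prod_overlap_bound (I : finType) (X Z : {set I}) (F c : I -> nat) e :
  Z \subset X -> (forall u, u \in X -> F u <= 2 ^ c u) ->
  (forall u, u \in Z -> 4 * F u <= 3 * 2 ^ c u) ->
  \sum_(u in X) c u <= e + #|Z| %/ 3 -> \prod_(u in X) F u <= 2 ^ e.
Proof.
move=> ZX Fc FZ he.
have split_prod (G : I -> nat) : \prod_(u in X) G u = \prod_(u in Z) G u * \prod_(u in X :\: Z) G u.
  rewrite (bigID (fun u => u \in Z)) /=; congr (_ * _); apply: eq_bigl => u.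
    by rewrite andb_idl // => /(subsetP ZX).
  by rewrite !inE andbC.
have le1 : 4 ^ #|Z| * \prod_(u in X) F u <= 3 ^ #|Z| * 2 ^ (\sum_(u in X) c u).
  rewrite -[2 ^ _]/(expn 2 _) (big_morph (expn 2) (expnD 2) (expn0 2)) /= !split_prod !mulnA.
  rewrite -!prod_nat_const -!big_split /=; apply: leq_mul.
    by apply: leq_prod.
  by apply: leq_prod => u; rewrite inE => /andP[_ /Fc].
have le2 := expn_three_quarters #|Z|.
have le3 : 2 ^ (\sum_(u in X) c u) <= 2 ^ e * 2 ^ (#|Z| %/ 3) by rewrite -expnD leq_pexp2l.
have p3 : 0 < 3 ^ #|Z| * 2 ^ (#|Z| %/ 3) by rewrite muln_gt0 !expn_gt0.
rewrite -(leq_pmul2l p3); apply: leq_trans (leq_mul le2 (leqnn _)) _.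
apply: leq_trans le1 _; rewrite -mulnA leq_mul2l; apply/orP; right.
by rewrite mulnC.
Qed.

(** Double counting of the pairs [(z, u)] with [u] in [C z]. *)
Lemma sum_card_fibers (I T : finType) (K : {set I}) (X : {set T}) (C : I -> {set T}) :
  (forall z, z \in K -> C z \subset X) ->
  \sum_(u in X) #|[set z in K | u \in C z]| = \sum_(z in K) #|C z|.
Proof.
move=> CX; rewrite (eq_bigr (fun u => \sum_(z in K) (u \in C z : nat))); last first.
  move=> u _; rewrite -sum1_card big_mkcond [RHS]big_mkcond /=.
  by apply: eq_bigr => z _; rewrite inE; case: (z \in K); case: (u \in C z).
rewrite exchange_big /=; apply: eq_bigr => z zK.
rewrite -sum1_card big_mkcond [RHS]big_mkcond /=; apply: eq_bigr => u _.
by case: (boolP (u \in C z)) => [/(subsetP (CX z zK))->|_] //; case: ifP.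
Qed.

(* Class (2): x and y have no s-clique in their common neighbourhood, so a vertex
   of [(Cf x :&: Cf y) :\: C] is not adjacent to both of them; this leaves at
   most 3/4 of the ways to join it to K, and (3/4)^3 <= 1/2. *)
Definition overlap_cut n (E : {set {set 'I_n}}) s h k h0 k0 kk e : Prop :=
  exists K : {set 'I_n}, #|K| = kk /\ exists x y, [/\ x \in K, y \in K, x != y &
  let X := ~: K in let N := nbr (restr E X) in
  exists Cf : {ffun 'I_n -> {set 'I_n}}, exists C : {set 'I_n},
  [/\ Cf \in pffun_on set0 (mem K) (mem (conts N h s.+1 k X)),
      C \in conts N h0 s k0 X,
      forall z, z \in K -> nbr E z :&: X \subset Cf z /\ Cf z \subset X,
      nbr E x :&: nbr E y :&: X \subset C &
      \sum_(z in K) #|Cf z| <= e + #|(Cf x :&: Cf y) :\: C| %/ 3]].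

(** After guessing [x], [y], [Cf] and [C], a vertex [u] outside [K] can only be joined to those [z]
    in [K] with [u] in [Cf z], and not to both [x] and [y] unless [u] lies in [C]. Double counting
    turns the total freedom into the sum of the [#|Cf z|], and the vertices of the overlap outside
    [C] supply the saving. *)
Lemma card_overlap_cut n q s h k h0 k0 kk e (XX : {set {set {set 'I_n}}}) :
  (forall E, E \in XX -> E \in Kfree_graphs q n /\ overlap_cut E s h k h0 k0 kk e) ->
  #|XX| <= 'C(n, kk) * (2 ^ (kk * kk) * (#|Kfree_graphs q (n - kk)| *
      (kk * (kk * ((n.+1 ^ (s.+1 * k)) ^ kk * (n.+1 ^ (s * k0) * 2 ^ e)))))).
Proof.
move=> XP.
pose T (K : {set 'I_n}) (Cf : {ffun 'I_n -> {set 'I_n}}) u := [set z in K | u \in Cf z].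
pose F K x y (Cf : {ffun 'I_n -> {set 'I_n}}) (C : {set 'I_n}) u :=
  if u \in C then powerset (T K Cf u)
  else [set S in powerset (T K Cf u) | ~~ ((x \in S) && (y \in S))].
pose ok (K : {set 'I_n}) x y (Cf : {ffun 'I_n -> {set 'I_n}}) (C : {set 'I_n}) :=
  \prod_(u in ~: K) #|F K x y Cf C u| <= 2 ^ e.
pose CF (K : {set 'I_n}) H :=
  [set Cf in pffun_on set0 (mem K) (mem (conts (nbr H) h s.+1 k (~: K)))].
pose Phi (K : {set 'I_n}) (H H' : {set {set 'I_n}}) :=
  \bigcup_(x in K) \bigcup_(y in K) \bigcup_(Cf in CF K H')
  \bigcup_(C in [set C in conts (nbr H') h0 s k0 (~: K) | ok K x y Cf C])
    [set g in pfamily set0 (mem (~: K)) (fun u => mem (F K x y Cf C u))].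
apply: (card_class (Phi := Phi)) => [E /XP[EK]|K H1 H2 cK].
  move=> [K [cK [x [y [xK yK xy [Cf [C [CfP CP nCf nC sm]]]]]]]].
  split=> //; exists K; split=> //.
  apply/bigcupP; exists x => //; apply/bigcupP; exists y => //.
  apply/bigcupP; exists Cf; first by rewrite inE.
  apply/bigcupP; exists C; last first.
    rewrite inE; apply/pfamilyP; split.
      by apply/supportP => u uK; rewrite ffunE (negbTE uK).
    move=> u uX; rewrite ffunE uX.
    have sub : nbr E u :&: K \subset T K Cf u.
      apply/subsetP => z; rewrite inE => /andP[zu zK]; rewrite inE zK /=.
      by apply: (subsetP (nCf z zK).1); rewrite inE uX nbrC zu.
    rewrite /F; case: (boolP (u \in C)) => uC; first by rewrite powersetE.
    rewrite inE powersetE sub /=; apply: contra uC => /andP[].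
    rewrite !(in_setI, nbrC E _ u) => /andP[xu _] /andP[yu _]; apply: (subsetP nC).
    by rewrite !in_setI xu yu uX.
  rewrite inE CP /ok /=.
  apply: (@prod_overlap_bound _ (~: K) ((Cf x :&: Cf y) :\: C) _ (fun u => #|T K Cf u|)).
  - by apply: subset_trans (subsetDl _ _) (subset_trans (subsetIl _ _) (nCf x xK).2).
  - move=> u _; rewrite -card_powerset /F; case: ifP => // _.
    by apply/subset_leq_card/subsetP => S; rewrite inE => /andP[].
  - move=> u; rewrite !inE => /andP[uC /andP[ux uy]]; rewrite /F (negbTE uC).
    by apply: card_avoid_pair; rewrite // inE ?xK ?yK.
  - by rewrite sum_card_fibers // => z /nCf[].
apply: leq_trans (leq_card_bigcup_const
  (b := kk * ((n.+1 ^ (s.+1 * k)) ^ kk * (n.+1 ^ (s * k0) * 2 ^ e))) _) _; last by rewrite cK.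
move=> x xK.
apply: leq_trans (leq_card_bigcup_const
  (b := (n.+1 ^ (s.+1 * k)) ^ kk * (n.+1 ^ (s * k0) * 2 ^ e)) _) _; last by rewrite cK.
move=> y yK.
apply: leq_trans (leq_card_bigcup_const (b := n.+1 ^ (s * k0) * 2 ^ e) _) _; last first.
  rewrite leq_mul2r; apply/orP; right; rewrite cardsE card_pffun_on cK.
  apply: leq_expn_base; apply: leq_trans (card_size _) _.
  by apply: leq_trans (size_conts _ _ _ _ _) _; rewrite card_ord.
move=> Cf _.
apply: leq_trans (leq_card_bigcup_const (b := 2 ^ e) _) _.
  by move=> C; rewrite inE => /andP[_ okC]; rewrite cardsE card_pfamily_prod.
rewrite leq_mul2r; apply/orP; right.
apply: leq_trans (_ : #|[set C in conts (nbr H2) h0 s k0 (~: K)]| <= _).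
  by apply/subset_leq_card/subsetP => C; rewrite !inE => /andP[].
rewrite cardsE; apply: leq_trans (card_size _) _.
by apply: leq_trans (size_conts _ _ _ _ _) _; rewrite card_ord.
Qed.

(** The lossless case [h' = 1] of the container lemma: a set without any [s]-clique is wholly
    contained, within [X], in a container computed from the graph induced on [X]. *)
Lemma container_of_nonrich n (E : {set {set 'I_n}}) (X S : {set 'I_n}) h s k al :
  0 < h -> n <= h * k -> (forall C, ~~ rich (nbr E) h s C -> #|C| < al) ->
  ~~ rich (nbr E) 1 s S ->
  exists C, [/\ C \in conts (nbr (restr E X)) h s k X, S :&: X \subset C, C \subset X & #|C| < al].
Proof.
move=> h0 hk hP nS.
have nS' : ~~ rich (nbr (restr E X)) 1 s (X :&: S).
  rewrite eq_rich_restr ?subsetIl //; apply: rich_setI nS => D _.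
  by rewrite ltnS leqn0 cards_eq0 => /eqP->; rewrite set0I cards0.
have [|C [Cin CX nC cC]] := conts_cover (C := X) (k := k) h0 _ nS'.
  by apply: leq_trans hk; apply: leq_trans (max_card _) _; rewrite card_ord.
exists C; split => //; last by apply: hP; rewrite -(eq_rich_restr _ _ _ CX).
move: cC; rewrite muln0 leqn0 cards_eq0 setD_eq0.
by rewrite setIC setIA setIid setIC.
Qed.


(** [B z] is the part of [~: K] outside a container [Cf z] of the neighbourhood of [z]. If [B x] and
    [B y] overlap in more than [q] vertices, then [Cf x :|: Cf y] is small, so [Cf x :&: Cf y] is
    large, mostly outside the container [C] of the common neighbourhood; this is an overlap cut. *)
Lemma overlap_dichotomy n (E : {set {set 'I_n}}) s h k al h0 k0 al0 kk e q be :
  is_graph E -> Kfree s.+2 E ->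
  0 < h -> n <= h * k -> (forall C, ~~ rich (nbr E) h s.+1 C -> #|C| < al) ->
  0 < h0 -> n <= h0 * k0 -> (forall C, ~~ rich (nbr E) h0 s C -> #|C| < al0) ->
  1 < kk -> kk <= n -> be + al + kk <= n ->
  (3 * kk - 2) * al + n + al0 + 2 <= 3 * e + q ->
  ~ overlap_cut E s h k h0 k0 kk e ->
  forall K : {set 'I_n}, #|K| <= kk -> exists B : 'I_n -> {set 'I_n},
     (forall x, x \in K -> be <= #|B x|) /\
     (forall x y, x \in K -> y \in K -> x != y -> ~~ shares_clique E s x y ->
        #|B x :&: B y| <= q).
Proof.
move=> gE kE hp hk hP h0p hk0 hP0 kk1 kkn hbe num nocut K0 cK0.
(* [overlap_cut] counts sets of exactly [kk] vertices, so the given set is first enlarged. *)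
have [K [K0K cK]] : exists K : {set 'I_n}, K0 \subset K /\ #|K| = kk.
  by apply: superset_of_card; rewrite ?card_ord.
pose X := ~: K; pose N := nbr (restr E X).
have cX : #|X| = n - kk by rewrite cardsCs setCK card_ord cK.
pose good z (C : {set 'I_n}) :=
  [&& C \in conts N h s.+1 k X, nbr E z :&: X \subset C, C \subset X & #|C| < al].
pose Cf := [ffun z => if z \in K then odflt set0 [pick C | good z C] else set0].
have CfP z : z \in K -> good z (Cf z).
  move=> zK; rewrite ffunE zK; case: pickP => //= no.
  have [C [h1 h2 h3 h4]] := container_of_nonrich X hp hk hP (Kfree_nbr z gE kE).
  by have := no C; rewrite /good h1 h2 h3 h4.
exists (fun z => X :\: Cf z); split.
  move=> z /(subsetP K0K) /CfP /and4P[_ _ CX cC].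
  rewrite cardsD (setIidPr CX) cX; move: hbe cC; clear; lia.
move=> x y /(subsetP K0K) xK /(subsetP K0K) yK xy nsim.
rewrite leqNgt; apply/negP => big; apply: nocut.
have /and4P[_ _ CxX cx] := CfP x xK; have /and4P[_ _ CyX cy] := CfP y yK.
have [C [Cin SC CX cC]] := container_of_nonrich X h0p hk0 hP0 nsim.
exists K; split=> //; exists x, y; split=> // XX NN; exists Cf, C; split => //.
- apply/pffun_onP; split.
    by apply/supportP => z zK; rewrite ffunE (negbTE zK).
  by move=> _ /imageP[z zK ->]; have /and4P[] := CfP z zK.
- by move=> z /CfP /and4P[].
have s1 : \sum_(z in K) #|Cf z| <= #|Cf x| + #|Cf y| + (kk - 2) * al.
  rewrite (bigD1 x) //= (bigD1 y) //=; last by rewrite yK eq_sym.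
  rewrite addnA leq_add2l.
  apply: leq_trans (_ : \sum_(z in K :\ x :\ y) al <= _).
    rewrite [X in X <= _](eq_bigl (fun z => z \in K :\ x :\ y)); last first.
      by move=> z; rewrite !inE andbC; case: (z \in K); rewrite ?andbF // andbT andbC.
    by apply: leq_sum => z; rewrite !inE => /and3P[_ _ /CfP /and4P[_ _ _ /ltnW]].
  rewrite sum_nat_const leq_mul2r; apply/orP; right.
  by rewrite -cK (cardsD1 x K) xK (cardsD1 y (K :\ x)) !inE eq_sym xy yK subSS subSS subn0.
apply: leq_trans s1 _.
set Z := (Cf x :&: Cf y) :\: C.
have z1 : #|Cf x :&: Cf y| <= #|Z| + #|C|.
  by rewrite -(cardsID C (Cf x :&: Cf y)) addnC leq_add2l; apply/subset_leq_card/subsetIr.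
have z2 := cardsUI (Cf x) (Cf y).
have z3 : #|(X :\: Cf x) :&: (X :\: Cf y)| + #|Cf x :|: Cf y| = n - kk.
  rewrite -cX -setDUr cardsD (setIidPr (_ : _ \subset X)) ?subUset ?CxX //.
  by rewrite subnK // subset_leq_card // subUset CxX.
(* The remainder modulo 3 is what the summand 2 in the numerical hypothesis absorbs. *)
have z4 := divn_eq #|Z| 3; have z5 := ltn_pmod #|Z| (isT : 0 < 3).
have z6 : (3 * kk - 2) * al = 3 * ((kk - 2) * al) + 4 * al.
  have -> : 3 * kk - 2 = 3 * (kk - 2) + 4 by move: kk1; clear; lia.
  by rewrite mulnDl mulnA.
move: num cx cy cC big z1 z2 z3 z4 z5; rewrite z6.
move: (_ * al) (#|Z| %/ 3) (#|Z| %% 3); clear; lia.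
Qed.

(** * Choice of parameters *)

Lemma bin_le_expn a b : 'C(a, b) <= 2 ^ a.
Proof.
have -> : 'C(a, b) = #|[set U : {set 'I_a} | U \subset [set: 'I_a] & #|U| == b]|.
  by rewrite cards_draws cardsT card_ord.
rewrite -[a in 2 ^ a]card_ord -cardsT -card_powerset.
by apply/subset_leq_card/subsetP => U _; rewrite powersetE subsetT.
Qed.

Lemma bin_le_pow a b : 'C(a, b) <= a.+1 ^ b.
Proof.
elim: a b => [|a IH] [|b] //; rewrite binS.
apply: leq_trans (leq_add (IH _) (IH _)) _.
rewrite !expnS -mulSnr; apply: leq_mul => //; exact: leq_expn_base.
Qed.

Lemma leq_double_trunc m z : 0 < z -> z <= m -> m <= m %/ z * (2 * z).
Proof.
move=> z0 zm; have := divn_eq m z; have := ltn_pmod m z0.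
have : 0 < m %/ z by rewrite divn_gt0.
move: (m %/ z) (m %% z) => a b a0 bz ->.
by rewrite mulnCA mul2n -addnn leq_add2l; apply: leq_trans (ltnW bz) _; rewrite leq_pmull.
Qed.

Lemma cube_leq_expn r : 2 ^ 10 * (r.+1) ^ 3 <= 2 ^ (r + 20).
Proof.
rewrite addnC; have -> : 2 ^ (20 + r) = 2 ^ 10 * (2 ^ 10 * 2 ^ r) by rewrite mulnA -!expnD.
rewrite leq_mul2l; apply/orP; right.
elim: r => [|r IH]; first by [].
have -> : 2 ^ 10 * 2 ^ r.+1 = 2 * (2 ^ 10 * 2 ^ r) by rewrite [2 ^ r.+1]expnS mulnCA.
case: (leqP r 3) => r3; first by case: r r3 IH => [|[|[|[|]]]].
apply: leq_trans (_ : 2 * r.+1 ^ 3 <= _); last by rewrite leq_mul2l IH orbT.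
rewrite -(subnK r3); move: (r - 4) => y; clear.
have -> : (y + 4).+2 = y + 6 by lia.
have -> : (y + 4).+1 = y + 5 by lia.
by rewrite !expnS !expn0 !muln1 !mulnDl !mulnDr; lia.
Qed.

(* A set of at least [al j] vertices has to be rich in (j+1)-cliques, at level
   [h j.+1].  The gaps h_(j+1)/m << h'_j/w << h_j/m, each by a power of 2^D, absorb the
   sampling error 1/[Y j] and the number [k j] of container rounds; they are allowed
   to shrink like 2^(-D^2) since n is at least 2^(r^4). *)
Section Recursion.
Variables (s D e m : nat).
Hypotheses (s0 : 0 < s) (sD : s + 21 <= D) (He : (8 * e + 8) * 2 ^ (40 * D ^ 2) <= 2 ^ e).
(** The exponent [e] has the order of the logarithm of [m]: the sample size [2 ^ e] is at most the
    cube root of [m], and naming a vertex costs at most [8 * e + 8] bits. *)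
Hypotheses (m_ge : 2 ^ (3 * e) <= m) (m_lt : m < 2 ^ (8 * e + 8)).

Let r := s.+1.
Let p := m %/ r.
Let d := m %/ 2 ^ (3 * D).
Let w := 2 ^ e.
Let h j := m %/ 2 ^ (10 * D * j).
Let k j := 2 * 2 ^ (10 * D * j).
(** About [j] parts of size [p]; each level, including level 0, adds one slack term [d] to pay for
    the errors. *)
Let al j := j * (p + d) + d.
Let h' j := 2 ^ (e - (10 * D * j + 9 * D)).
Let Y j := 2 ^ (10 * D * j + 10 * D).
Let L j := (8 * e + 8) * 2 ^ (10 * D * j + 2 * D).

Lemma D_sq_le_e : 40 * D ^ 2 <= e.
Proof.
rewrite -(leq_exp2l (m := 2)) //; apply: leq_trans He.
by rewrite leq_pmull // addnC.
Qed.

Lemma D_gt20 : 20 < D. Proof. by apply: leq_trans sD; rewrite leq_addl. Qed.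

(** Keeps every exponent [10 * D * j] well below [40 * D ^ 2], hence below [e]. *)
Lemma D_mul_le_sq j : j <= s -> D * j + 21 * D <= D ^ 2.
Proof. by move=> js; rewrite -mulnn [21 * D]mulnC -mulnDr leq_mul2l; move: js sD; clear; lia. Qed.

Lemma cube_le_expD : 2 ^ 10 * r.+1 ^ 3 <= 2 ^ D.
Proof.
apply: leq_trans (cube_leq_expn r) _; rewrite leq_pexp2l //.
by move: sD; rewrite /r; clear; lia.
Qed.

Lemma expn_le_m x : x <= 3 * e -> 2 ^ x <= m.
Proof. by move=> xe; apply: leq_trans m_ge; rewrite leq_pexp2l. Qed.

Lemma richness_fuel j : j <= r -> 0 < h j /\ m <= h j * k j.
Proof.
move=> jr; have le : 2 ^ (10 * D * j) <= m.
  apply: expn_le_m; have := D_sq_le_e; have := D_mul_le_sq (leqnn s).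
  move: jr; rewrite /r => jr; have : D * j <= D * s + D by rewrite -mulnSr leq_mul2l jr orbT.
  by rewrite -!mulnA; clear; lia.
by rewrite /h /k divn_gt0 ?expn_gt0 // le leq_double_trunc ?expn_gt0.
Qed.

Lemma slack_bounds : 0 < d /\ m <= d * (2 * 2 ^ (3 * D)).
Proof.
have le : 2 ^ (3 * D) <= m.
  by apply: expn_le_m; have := D_sq_le_e; have := D_mul_le_sq (leqnn s); clear; lia.
by rewrite /d divn_gt0 ?expn_gt0 // le leq_double_trunc ?expn_gt0.
Qed.

Lemma m_le_part a : p + d <= a -> m <= a * r.
Proof.
move=> pa; have := divn_eq m r; have := ltn_pmod m (ltn0Sn s); rewrite -/p -/r => lt ->.
apply: leq_trans (_ : p * r + r <= _); first by rewrite leq_add2l ltnW.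
rewrite -mulSnr leq_mul2r; apply/orP; right.
by apply: leq_trans pa; rewrite -addn1 leq_add2l; case: slack_bounds.
Qed.

Lemma sampling_params j a0 : 0 < j -> j <= s -> al j <= a0 -> a0 <= m ->
  [/\ 0 < a0, 2 * w ^ 2 <= a0,
      m.+1 ^ (j * k j) + m * m.+1 ^ j <= 2 ^ L j,
      8 * Y j ^ 2 * (L j + 2) <= w &
      (h j.+1 * Y j + a0) * w < h' j * (a0 * Y j)].
Proof.
move=> j0 js ala am.
have De := D_sq_le_e; have Ds := D_mul_le_sq js; have T := cube_le_expD; have D20 := D_gt20.
have ar : m <= a0 * r.
  apply: m_le_part; apply: leq_trans ala; rewrite /al -{1}[p + d]mul1n.
  by apply: leq_trans (leq_addr _ _); rewrite leq_mul2r j0 orbT.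
have m0 : 0 < m by apply: leq_trans m_ge; rewrite expn_gt0.
have a00 : 0 < a0 by case: a0 ar {ala am} => //; rewrite mul0n leqNgt m0.
have r3 : r.+1 <= r.+1 ^ 3 by rewrite -{1}[r.+1]expn1 leq_pexp2l.
have rT : r.+1 < 2 ^ D.
  apply: leq_trans T; apply: leq_trans (_ : 2 ^ 10 * r.+1 <= _); last by rewrite leq_mul2l r3 orbT.
  by move: (r.+1) (ltn0Sn r); clear; lia.
split => //.
- have r0 : 0 < r by [].
  rewrite -(leq_pmul2r r0); apply: leq_trans ar; apply: leq_trans m_ge.
  apply: leq_trans (leq_mul (leqnn _) (ltnW (ltnW rT))) _.
  rewrite /w -expnM -{1}[2]expn1 -!expnD leq_pexp2l //.
  by move: De Ds D20; move: (D * j) (D ^ 2); clear; lia.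
- have m1 x : m.+1 ^ x <= 2 ^ ((8 * e + 8) * x) by rewrite expnM; apply: leq_expn_base.
  have jT : 3 * j + 2 <= 2 ^ (2 * D).
    apply: leq_trans (_ : 2 ^ D * 2 ^ D <= _); last by rewrite -expnD addnn mul2n.
    apply: leq_trans (_ : r.+1 * r.+1 <= _); last by apply: leq_mul; apply: ltnW.
    by move: js s0; rewrite /r; clear; nia.
  pose x := (8 * e + 8) * (j * k j + j + 1).
  apply: leq_trans (_ : 2 ^ x + 2 ^ x <= _).
    apply: leq_add.
      by apply: leq_trans (m1 _) _; rewrite leq_pexp2l // leq_mul2l -addnA leq_addr orbT.
    apply: leq_trans (_ : m.+1 ^ j.+1 <= _); first by rewrite expnS leq_mul2r leqnSn orbT.
    by apply: leq_trans (m1 _) _; rewrite leq_pexp2l // leq_mul2l -addnA addn1 leq_addl orbT.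
  rewrite addnn -mul2n -expnS leq_pexp2l // /L expnD /x.
  have P : 0 < 2 ^ (10 * D * j) by rewrite expn_gt0.
  apply: leq_trans (_ : (8 * e + 8) * (j * k j + j + 2) <= _).
    by rewrite !mulnDr; clear; lia.
  rewrite leq_mul2l; apply/orP; right.
  apply: leq_trans (leq_mul (leqnn _) jT); rewrite /k.
  by move: P; clear; nia.
- have LL : L j + 2 <= (8 * e + 8) * 2 ^ (10 * D * j + 2 * D + 1).
    rewrite /L [2 ^ (_ + 1)]expnD expn1 mulnA muln2 -addnn leq_add2l.
    have : 0 < 2 ^ (10 * D * j + 2 * D) by rewrite expn_gt0.
    by move: (2 ^ _); clear; nia.
  apply: leq_trans (leq_mul (leqnn _) LL) _; apply: leq_trans He.
  rewrite mulnCA leq_mul2l; apply/orP; right; rewrite /Y -[8]/(2 ^ 3) -expnM -!expnD.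
  rewrite leq_pexp2l //; move: De Ds D20; rewrite -!mulnA; move: (D * j) (D ^ 2); clear; lia.
(* After cancelling common powers of 2 this reads [m + a0 < a0 * 2 ^ D] up to rounding, which
   follows from [m <= a0 * r] and [r.+1 < 2 ^ D]. *)
- have -> : w = h' j * 2 ^ (10 * D * j + 9 * D).
    rewrite /w /h' -expnD subnK //; move: Ds De D20; rewrite -!mulnA.
    by move: (D * j) (D ^ 2); clear; lia.
  rewrite [_ * (h' j * _)]mulnCA ltn_pmul2l ?expn_gt0 // mulnC.
  have -> : a0 * Y j = 2 ^ (10 * D * j + 9 * D) * (a0 * 2 ^ D).
    rewrite mulnCA -expnD /Y; congr (_ * 2 ^ _); rewrite -!mulnA; move: (D * j); clear; lia.
  rewrite ltn_pmul2l ?expn_gt0 //.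
  apply: leq_ltn_trans (_ : a0 * r + a0 < _).
    rewrite leq_add2r; apply: leq_trans ar; rewrite /h /Y.
    by rewrite (_ : 10 * D * j.+1 = 10 * D * j + 10 * D) ?leq_trunc_div // mulnSr.
  by rewrite -mulnSr ltn_pmul2l.
Qed.

(** The slack [w * d] is of order [w * m / 2 ^ (3 * D)] and must cover seven error terms, each at
    most [m * z] with [z = w / 2 ^ (4 * D)]. *)
Lemma sampling_gain j a0 : 0 < j -> j <= s -> al j <= a0 -> a0 <= m ->
  w * p + 5 * m + m * (2 ^ (e - (10 * D * j + 10 * D)) + L j +
      (2 * 2 ^ (e - 5 * D) + (5 * D).-1.+1 * (k j * h' j))) + w * (h j.+1 + w)
  <= w * (p + d).
Proof.
move=> j0 js ala am.
have De := D_sq_le_e; have Ds := D_mul_le_sq js; have D20 := D_gt20.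
have [_ _ _ iv _] := sampling_params j0 js ala am.
pose z := 2 ^ (e - 4 * D).
have wz : w = z * 2 ^ (4 * D).
  by rewrite /w /z -expnD subnK //; move: Ds De D20; move: (D * j) (D ^ 2); clear; lia.
have e1 : 5 <= z.
  apply: (@leq_trans (2 ^ 3)) => //; rewrite leq_pexp2l //.
  by move: Ds De D20; move: (D * j) (D ^ 2); clear; lia.
have e2 : 2 ^ (e - (10 * D * j + 10 * D)) <= z.
  by rewrite leq_pexp2l //; clear; lia.
have e3 : L j <= z.
  rewrite -(leq_pmul2r (_ : 0 < 2 ^ (4 * D))) ?expn_gt0 // -wz; apply: leq_trans iv.
  rewrite mulnC; apply: leq_mul; last exact: leq_addr.
  apply: leq_trans (_ : Y j ^ 2 <= _); last by rewrite leq_pmull.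
  by rewrite /Y -expnM leq_pexp2l //; clear; lia.
have e4 : 2 * 2 ^ (e - 5 * D) <= z.
  by rewrite -expnS leq_pexp2l //; move: Ds De D20; move: (D * j) (D ^ 2); clear; lia.
have e5 : (5 * D).-1.+1 * (k j * h' j) <= z.
  have -> : k j * h' j = 2 ^ (e - 9 * D + 1).
    rewrite /k /h' -expnS -expnD; congr (2 ^ _); move: Ds De D20; rewrite -!mulnA.
    by move: (D * j) (D ^ 2); clear; lia.
  rewrite prednK; last by move: D20; clear; lia.
  apply: leq_trans (_ : 2 ^ (3 + D) * 2 ^ (e - 9 * D + 1) <= _).
    rewrite leq_mul2r [2 ^ (3 + D)]expnD; apply/orP; right.
    exact: (@leq_mul 5 _ (2 ^ 3) _ isT (ltnW (ltn_expl D (isT : 1 < 2)))).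
  by rewrite -expnD leq_pexp2l //; move: Ds De D20; move: (D * j) (D ^ 2); clear; lia.
have e6 : w * h j.+1 <= m * z.
  rewrite wz -mulnA [m * z]mulnC leq_mul2l; apply/orP; right.
  rewrite mulnC; apply: leq_trans (leq_trunc_div m (2 ^ (10 * D * j.+1))).
  rewrite leq_mul2l leq_pexp2l ?orbT // mulnS; clear; lia.
have e7 : w * w <= m * z.
  apply: leq_trans (leq_mul m_ge (leqnn z)); rewrite /w /z -!expnD leq_pexp2l //.
  by move: Ds De D20; move: (D * j) (D ^ 2); clear; lia.
have e8 : 7 * (m * z) <= w * d.
  rewrite wz; have [_ md] := slack_bounds.
  apply: leq_trans (_ : 7 * (d * (2 * 2 ^ (3 * D)) * z) <= _).
    by rewrite leq_mul2l leq_mul2r md orbT.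
  have -> : 7 * (d * (2 * 2 ^ (3 * D)) * z) = z * (14 * 2 ^ (3 * D)) * d by clear; lia.
  rewrite leq_mul2r leq_mul2l; apply/orP; right; apply/orP; right.
  apply: leq_trans (_ : 2 ^ 4 * 2 ^ (3 * D) <= _); first by rewrite leq_mul2r orbT.
  by rewrite -expnD leq_pexp2l //; move: D20; clear; lia.
rewrite -addnA -addnA [w * (p + d)]mulnDr leq_add2l.
apply: leq_trans e8; rewrite [w * (h _ + w)]mulnDr.
have f1 : 5 * m <= m * z by rewrite mulnC leq_mul2l e1 orbT.
move: e2 e3 e4 e5; set x1 := 2 ^ (_ - (_ + _)); set x2 := L j.
set x3 := 2 * _; set x4 := _ * (k j * _).
move=> e2 e3 e4 e5.
have f2 : m * (x1 + x2 + (x3 + x4)) <= m * (4 * z).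
  by rewrite leq_mul2l; apply/orP; right; move: e2 e3 e4 e5; clear; lia.
have f3 : m * (4 * z) = 4 * (m * z) by rewrite mulnCA.
by move: f1 f2 e6 e7; rewrite f3; move: (m * z) (m * _) (w * h _) (w * w); clear; lia.
Qed.

(** Induction on [j]: a poor set of size at least [al j.+1], sampled with the bound [al j] for its
    containers, would produce a forbidden sparse cut. At [j = 0] a poor set simply has fewer than
    [h 1 <= d] elements. *)
Lemma container_bounds (R : realType) (E : {set {set 'I_m}}) :
  (forall j, 0 < j -> j <= s -> ~ sparse_cut E (h' j) j w (w * p + 5 * m)) ->
  forall j, j <= s -> forall C, ~~ rich (nbr E) (h j.+1) j.+1 C -> #|C| < al j.
Proof.
move=> nocut; elim=> [|j IH] js C.
  rewrite /= -ltnNge /al mul0n add0n => hC.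
  have : #|C| < h 1.
    by apply: leq_ltn_trans hC; apply/subset_leq_card/subsetP => x xC; rewrite inE xC.
  move/leq_trans; apply; rewrite /h /d muln1 leq_div2l ?expn_gt0 // leq_pexp2l //.
  by clear; lia.
move=> nC; rewrite ltnNge; apply/negP => big.
have am : #|C| <= m by apply: leq_trans (max_card _) _; rewrite card_ord.
have [c1 c2 c3 c4 c5] := sampling_params (ltn0Sn j) js big am.
have gain := sampling_gain (ltn0Sn j) js big am.
have [hp hk] := richness_fuel (ltnW js : j.+1 <= r).
apply: (nocut j.+1 (ltn0Sn j) js).
have := @sparse_witness R _ (nbr E) C (h j.+1) (h j.+2) (h' j.+1) j.+1 (k j.+1) w
  (2 ^ (e - (10 * D * j.+1 + 10 * D))) (Y j.+1) (L j.+1) (p + d) (al j) (5 * D).-1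
  (2 ^ (e - 5 * D)) (w * p + 5 * m) hp.
rewrite card_ord => /(_ hk (IH (ltnW js))).
apply => //.
- by apply: leq_trans big; rewrite /al mulSn; clear; lia.
- by rewrite expn_gt0.
- rewrite /w /Y -expnD subnKC //.
  have De := D_sq_le_e; have Ds := D_mul_le_sq js; have D20 := D_gt20.
  by move: Ds De D20; rewrite -!mulnA; move: (D * j.+1) (D ^ 2); clear; lia.
- rewrite prednK; last by have := D_gt20; clear; lia.
  rewrite /w -expnD subnKC //; have De := D_sq_le_e; have Ds := D_mul_le_sq js; have D20 := D_gt20.
  by move: Ds De D20; move: (D * j.+1) (D ^ 2); clear; lia.
Qed.

(** * Numerical conditions for rigidity and for the overlap class *)

Let kk := 2 * s + 3.
Let q := m %/ 2 ^ D.
Let be := m - kk - al s.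
(** The typical exponent for attaching [kk] vertices, each to about [m - p] others, less the gain
    from an overlap of size [q]. *)
Let ee := kk * (m - p) - q %/ 4.

Lemma q_bounds : q * 2 ^ D <= m /\ m <= q * (2 * 2 ^ D).
Proof.
rewrite /q leq_trunc_div leq_double_trunc ?expn_gt0 //; apply: expn_le_m.
by have := D_sq_le_e; have := D_mul_le_sq (leqnn s); move: (D * s) (D ^ 2); clear; lia.
Qed.

(** All error terms are small against one part: [q] and [d] are at most [m / 2 ^ D], and [2 ^ D]
    exceeds [2 ^ 10] times the cube of [s + 2]. *)
Lemma part_size_dominates : 7 * (s + 2) ^ 2 * q + 4 * (s + 2) * (kk + r * d) < p.
Proof.
have [qT _] := q_bounds; have T := cube_le_expD; have D20 := D_gt20.
have dT : d * 2 ^ D <= m.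
  apply: leq_trans (_ : d * 2 ^ (3 * D) <= _); last exact: leq_trunc_div.
  by rewrite leq_mul2l leq_pexp2l ?orbT //; clear; lia.
have Tm : 2 ^ D <= m.
  apply: expn_le_m; have := D_sq_le_e; have := D_mul_le_sq (leqnn s).
  by move: (D * s) (D ^ 2); clear; lia.
have r0 : 0 < r by [].
have Sr : r.+1 = s + 2 by rewrite addn2.
rewrite Sr in T; set S := s + 2 in Sr T *; set T0 := 2 ^ D in qT dT Tm T.
have S1 : 0 < S by rewrite -Sr.
have rS : r <= S by rewrite -Sr.
have kS : kk <= 2 * S by rewrite /kk /S; clear; lia.
have S3 : S <= S ^ 3 by rewrite -{1}[S]expn1 leq_pexp2l.
have a1 : 2 ^ 10 * (S ^ 3 * q) <= m.
  by apply: leq_trans qT; rewrite mulnA mulnC leq_mul2l T orbT.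
have a2 : 2 ^ 10 * (S ^ 3 * d) <= m.
  by apply: leq_trans dT; rewrite mulnA mulnC leq_mul2l T orbT.
have a3 : 2 ^ 10 * S ^ 3 <= m by apply: leq_trans T Tm.
rewrite -(ltn_pmul2l r0).
have pr : m < r * p + r.
  by rewrite {1}(divn_eq m r) -/p mulnC ltn_add2l ltn_pmod.
have b1 : r * (7 * S ^ 2 * q) <= 7 * (S ^ 3 * q).
  have -> : 7 * (S ^ 3 * q) = S * (7 * S ^ 2 * q) by rewrite expnS; clear; lia.
  by rewrite leq_mul2r rS orbT.
have b2 : r * (4 * S * (kk + r * d)) <= 8 * S ^ 3 + 4 * (S ^ 3 * d).
  apply: leq_trans (leq_mul rS (leq_mul (leqnn _) (leq_add kS (leq_mul rS (leqnn d))))) _.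
  by rewrite (_ : S * _ = 8 * S ^ 3 + 4 * (S ^ 3 * d)) //; ring.
rewrite mulnDr; move: a1 a2 a3 b1 b2 pr (leq_trans rS S3).
rewrite [2 ^ 10](_ : _ = 1024) //.
move: (S ^ 3 * q) (S ^ 3 * d) (S ^ 3) (r * _) (r * (4 * _ * _)) (r * p); clear; lia.
Qed.
Lemma rp_le_m : r * p <= m.
Proof. by rewrite mulnC leq_trunc_div. Qed.

Lemma al_le : al s + p <= m + r * d.
Proof.
rewrite /al mulnDr; have := rp_le_m; rewrite /r !mulSn.
by move: (s * p) (s * d); clear; lia.
Qed.

Lemma be_eq : be + al s + kk = m.
Proof.
have pb := part_size_dominates; have al_le := al_le.
have : kk + r * d <= 4 * (s + 2) * (kk + r * d) by rewrite leq_pmull // muln_gt0 addn_gt0 orbT.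
move: pb al_le; rewrite /be; move: (4 * (s + 2) * (kk + r * d)) (r * d) (7 * (s + 2) ^ 2 * q).
by clear; lia.
Qed.

Lemma be_num1 : m + (s + 2) ^ 2 * q < (s + 2) * be.
Proof.
have pb := part_size_dominates; have beE := be_eq; have rp := rp_le_m.
have e1 : (s + 2) * (be + al s + kk) = (s + 2) * m by rewrite beE.
(* From [(s + 2) * s + 1 = r ^ 2] it follows that [(s + 2) * be] exceeds [m] by [p] up to error
   terms, and [p] dominates these. *)
have e2 : (s + 2) * al s + p = r * (r * p) + (s + 2) * (r * d) by rewrite /al /r -addn1; ring.
have e3 : r * (r * p) <= r * m by rewrite leq_mul2l rp orbT.
have e4 : (s + 2) * m = r * m + m by rewrite /r -addn1; ring.
have e5 : 4 * (s + 2) * (kk + r * d) = 4 * ((s + 2) * kk) + 4 * ((s + 2) * (r * d)) by ring.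
have e6 : 7 * (s + 2) ^ 2 * q = 7 * ((s + 2) ^ 2 * q) by ring.
rewrite [_ * (_ + kk)]mulnDr [_ * (be + _)]mulnDr e4 in e1; rewrite e5 e6 in pb; move: e1 pb e2 e3.
move: ((s + 2) * be) ((s + 2) * al s) ((s + 2) * kk) ((s + 2) * (r * d)) ((s + 2) ^ 2 * q).
move: (r * (r * p)) (r * m); clear; lia.
Qed.

Lemma be_num2 : 3 * m + (6 * (s + 1) ^ 2 + 1) * q < (3 * s + 4) * be.
Proof.
have pb := part_size_dominates; have beE := be_eq; have rp := rp_le_m.
have e1 : (3 * s + 4) * (be + al s + kk) = (3 * s + 4) * m by rewrite beE.
(* The analogous identity is [(3 * s + 4) * s + 1 = (3 * s + 1) * (s + 1)]; again a surplus of [p]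
   remains. *)
have e2 : (3 * s + 4) * al s + p = (3 * s + 1) * (r * p) + (3 * s + 4) * (r * d).
  by rewrite /al /r -addn1; ring.
have e3 : (3 * s + 1) * (r * p) <= (3 * s + 1) * m by rewrite leq_mul2l rp orbT.
have e4 : (3 * s + 4) * m = (3 * s + 1) * m + 3 * m by ring.
have e5 : (3 * s + 4) * (kk + r * d) <= 4 * (s + 2) * (kk + r * d).
  by rewrite leq_mul2r; apply/orP; right; clear; lia.
have e6 : (6 * (s + 1) ^ 2 + 1) * q <= 7 * (s + 2) ^ 2 * q.
  rewrite leq_mul2r; apply/orP; right.
  have -> : 7 * (s + 2) ^ 2 = 6 * (s + 1) ^ 2 + 1 + (s * s + 16 * s + 21) by ring.
  exact: leq_addr.
rewrite [_ * (_ + kk)]mulnDr [_ * (be + _)]mulnDr e4 in e1.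
rewrite [(3 * s + 4) * _]mulnDr in e5; move: e1 pb e5 e2 e3 e6.
move: ((3 * s + 4) * be) ((3 * s + 4) * al s) ((3 * s + 4) * kk) ((3 * s + 4) * (r * d)).
move: ((3 * s + 1) * (r * p)) ((3 * s + 1) * m) ((6 * (s + 1) ^ 2 + 1) * q).
by move: (7 * (s + 2) ^ 2 * q) (4 * (s + 2) * (kk + r * d)); clear; lia.
Qed.

Lemma overlap_size_ge : 24 * (s + 2) ^ 2 * d + 8 <= q.
Proof.
have [_ qT] := q_bounds; have T := cube_le_expD; have D20 := D_gt20.
have dT : d * 2 ^ (3 * D) <= m by apply: leq_trunc_div.
have T0 : 0 < 2 * 2 ^ D by rewrite muln_gt0 expn_gt0.
rewrite -(leq_pmul2r T0); apply: leq_trans qT.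
have Tm : 2 ^ 5 * 2 ^ D <= m.
  rewrite -expnD; apply: expn_le_m; have := D_sq_le_e; have := D_mul_le_sq (leqnn s).
  by move: (D * s) (D ^ 2) D20; clear; lia.
have ST : 96 * (s + 2) ^ 2 <= 2 ^ D.
  apply: leq_trans T; have -> : r.+1 = s + 2 by rewrite addn2.
  apply: leq_mul => //; rewrite leq_pexp2l // addn2 //.
have e1 : 96 * (s + 2) ^ 2 * (d * 2 ^ D) <= m.
  apply: leq_trans dT; have -> : d * 2 ^ (3 * D) = 2 ^ D * (d * 2 ^ (2 * D)).
    by rewrite mulnCA -expnD; congr (_ * 2 ^ _); clear; lia.
  by apply: leq_mul => //; rewrite leq_mul2l leq_pexp2l ?orbT //; clear; lia.
have -> : (24 * (s + 2) ^ 2 * d + 8) * (2 * 2 ^ D) =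
  48 * (s + 2) ^ 2 * (d * 2 ^ D) + 16 * 2 ^ D by ring.
have e2 : 96 * (s + 2) ^ 2 * (d * 2 ^ D) = 2 * (48 * (s + 2) ^ 2 * (d * 2 ^ D)) by ring.
move: e1 Tm; rewrite e2 [2 ^ 5](_ : _ = 32) //.
by move: (48 * (s + 2) ^ 2 * (d * 2 ^ D)) (2 ^ D); clear; lia.
Qed.

(** The main terms agree exactly, since [(6 * s + 7) * (m - p) + m + (m - 2 * p) = 3 * kk * (m -
    p)]; what is left of [q] after subtracting [3 * (q %/ 4)] pays for the slack in [d]. The second
    part makes the subtraction in [ee] exact. *)
Lemma overlap_params :
  (3 * kk - 2) * al s + m + al s.-1 + 2 <= 3 * ee + q /\ q %/ 4 <= kk * (m - p).
Proof.
have pb := part_size_dominates; have rp := rp_le_m; have qn := overlap_size_ge; have al_le := al_le.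
have qp : q <= p.
  apply: leq_trans (ltnW pb); apply: leq_trans (leq_addr _ _).
  by rewrite leq_pmull // muln_gt0 expn_gt0 addn_gt0 orbT.
have p2 : 2 * p <= m by apply: leq_trans rp; rewrite leq_mul2r ltnS s0 orbT.
have qk : q %/ 4 <= kk * (m - p).
  apply: leq_trans (leq_div _ _) _; apply: leq_trans (_ : m - p <= _).
    by move: qp p2; clear; lia.
  by rewrite leq_pmull // /kk addn3.
split => //.
have a1 : al s <= m - p + r * d by move: al_le p2; move: (r * d); clear; lia.
have a2 : al s.-1 <= m - 2 * p + r * d.
  have : al s.-1 + (p + d) = al s.
    by rewrite /al; case: s s0 => // s' _; rewrite mulSn /=; clear; lia.
  by move: al_le p2; move: (r * d); clear; lia.
have k1 : 3 * kk - 2 = 6 * s + 7 by rewrite /kk; clear; lia.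
have k2 : 3 * kk = 6 * s + 9 by rewrite /kk; clear; lia.
have e1 : (3 * kk - 2) * al s <= (6 * s + 7) * (m - p) + (6 * s + 7) * (r * d).
  by rewrite k1 -mulnDr leq_mul2l a1 orbT.
have e2 : 3 * ee + 3 * (q %/ 4) = (6 * s + 7) * (m - p) + 2 * (m - p).
  by rewrite /ee -mulnDr subnK // mulnA k2 -mulnDl; congr (_ * _); clear; lia.
have e3 : (6 * s + 8) * (r * d) <= 6 * (s + 2) ^ 2 * d.
  rewrite mulnA leq_mul2r; apply/orP; right.
  have -> : 6 * (s + 2) ^ 2 = (6 * s + 8) * r + (10 * s + 16) by rewrite /r -addn1; ring.
  exact: leq_addr.
have e4 : (6 * s + 8) * (r * d) = (6 * s + 7) * (r * d) + r * d by ring.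
have e5 : 24 * (s + 2) ^ 2 * d = 4 * (6 * (s + 2) ^ 2 * d) by ring.
have q4 := leq_trunc_div q 4.
have m1 : m - p + p = m by move: p2; clear; lia.
have m2 : m - 2 * p + p = m - p by move: p2; clear; lia.
move: e1 e2 e3 e4 a2 qn q4 m1 m2; rewrite e5.
move: ((3 * kk - 2) * al s) (al s.-1) (3 * ee) ((6 * s + 7) * (m - p)) ((6 * s + 7) * (r * d)).
move: ((6 * s + 8) * (r * d)) (6 * (s + 2) ^ 2 * d) (r * d) (q %/ 4) (m - 2 * p) (m - p).
by move: q p; clear; lia.
Qed.

Lemma partite_of_no_cut (R : realType) (E : {set {set 'I_m}}) :
  is_graph E -> Kfree r.+1 E ->
  (forall j, 0 < j -> j <= s -> ~ sparse_cut E (h' j) j w (w * p + 5 * m)) ->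
  ~ overlap_cut E s (h r) (k r) (h s) (k s) kk ee -> partite r E.
Proof.
move=> gE kE nsparse noverlap; have cb := container_bounds R nsparse.
have [en _] := overlap_params.
have [hr1 hr2] := richness_fuel (leqnn r); have [hs1 hs2] := richness_fuel (leqnSn s).
apply: (rigid_partite (q := q) gE kE _ be_num1 be_num2) => K cK.
apply: (overlap_dichotomy gE kE hr1 hr2 _ hs1 hs2 _ _ _ _ en noverlap cK).
- exact: cb.
- by move=> C; have := cb s.-1 (leq_pred s) C; rewrite prednK.
- by rewrite /kk addn3.
- by rewrite -be_eq leq_addl.
- by rewrite be_eq.
Qed.

(** The term [w * p] of the gain gives the exponent of the partite growth. The further [5 * m] pays
    for four factors of at most [2 ^ m]: the choice of [W], the edges inside [W], the choice of [U],
    and [2 ^ (e + s)]. *)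
Lemma sparse_cut_rare (X : {set {set {set 'I_m}}}) j :
  (forall E, E \in X -> E \in Kfree_graphs r.+1 m /\
     sparse_cut E (h' j) j w (w * p + 5 * m)) ->
  2 ^ (e + s) * #|X| <= 2 ^ (w * (m - w - p)) * #|Kfree_graphs r.+1 (m - w)|.
Proof.
move=> /card_sparse_cut XP; apply: leq_trans (leq_mul (leqnn _) XP) _.
set f := #|Kfree_graphs _ _|.
have De := D_sq_le_e; have Ds := D_mul_le_sq (leqnn s); have D20 := D_gt20; have rp := rp_le_m.
have p2 : 2 * p <= m by apply: leq_trans rp; rewrite leq_mul2r ltnS s0 orbT.
have w2 : w * w <= m by rewrite /w -expnD; apply: expn_le_m; clear; lia.
have w32 : 2 ^ 5 <= w.
  by rewrite /w leq_pexp2l //; move: De Ds D20; move: (D * s) (D ^ 2); clear; lia.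
have wm : 32 * w <= m by apply: leq_trans w2; rewrite leq_mul2r w32 orbT.
have em : e + s <= m.
  apply: leq_trans wm.
  have ew : e < w by apply: ltn_expl.
  have sw : s <= w.
    apply: leq_trans (ltnW ew); move: De Ds D20 sD; move: (D * s) (D ^ 2); clear; lia.
  by move: ew sw; clear; lia.
have big : 5 * m <= w * (m - w - p).
  apply: leq_trans (_ : 32 * (m - w - p) <= _); last by rewrite leq_mul2r w32 orbT.
  by move: wm p2; clear; lia.
have -> : w * (m - w) - (w * p + 5 * m) = w * (m - w - p) - 5 * m.
  by rewrite subnDA -mulnBr.
set x := w * (m - w - p) in big *.
have -> : 2 ^ x = 2 ^ (x - 5 * m) * 2 ^ (5 * m) by rewrite -expnD subnK.
set y := 2 ^ (x - 5 * m).
apply: leq_trans (_ : 2 ^ m * (2 ^ m * (2 ^ m * (f * (2 ^ m * y)))) <= _).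
  apply: leq_mul; first by rewrite leq_pexp2l.
  apply: leq_mul; first exact: bin_le_expn.
  by apply: leq_mul => //; rewrite leq_pexp2l.
have -> : 2 ^ m * (2 ^ m * (2 ^ m * (f * (2 ^ m * y)))) = y * 2 ^ (4 * m) * f.
  have -> : 4 * m = m + m + m + m by clear; lia.
  by rewrite !expnD; ring.
by rewrite leq_mul2r leq_mul2l leq_pexp2l ?orbT // leq_mul2r orbT.
Qed.

Lemma overlap_cut_rare (X : {set {set {set 'I_m}}}) :
  (forall E, E \in X -> E \in Kfree_graphs r.+1 m /\
     overlap_cut E s (h r) (k r) (h s) (k s) kk ee) ->
  2 ^ e * #|X| <= 2 ^ (kk * (m - kk - p)) * #|Kfree_graphs r.+1 (m - kk)|.
Proof.
move=> /card_overlap_cut XP; apply: leq_trans (leq_mul (leqnn _) XP) _.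
set f := #|Kfree_graphs _ _|.
have De := D_sq_le_e; have Ds := D_mul_le_sq (leqnn s); have D20 := D_gt20; have rp := rp_le_m.
have [_ qk] := overlap_params; have [_ qT] := q_bounds; have T := cube_le_expD.
set M := 8 * e + 8.
have m1 x : m.+1 ^ x <= 2 ^ (M * x) by rewrite expnM; apply: leq_expn_base.
have kp : kk + p <= m.
  apply: leq_trans rp; rewrite /r mulSn addnC leq_add2l.
  apply: leq_trans (_ : p <= _); last by rewrite leq_pmull.
  apply: leq_trans (ltnW part_size_dominates); apply: leq_trans (leq_addl _ _).
  rewrite mulnDr; apply: leq_trans (leq_addr _ _).
  by rewrite leq_pmull // muln_gt0 addn_gt0 orbT.
have split_e : kk * (m - p) = kk * (m - kk - p) + kk * kk.
  by rewrite -mulnDr; congr (_ * _); move: kp; clear; lia.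
(* All costs must fit into the gain [q %/ 4]: the factor [2 ^ e], the choices of [K], the edges
   inside [K], the pair [x], [y], and the containers. The last [kk * kk] comes from replacing
   [m - p] by [m - kk - p]. Each of the seven summands is at most [B0]. *)
have key : e + M * kk + kk * kk + 2 * kk + M * (r * k r * kk) + M * (s * k s) + kk * kk <= q %/ 4.
  set T0 := 2 ^ D in T qT; set ka := 2 ^ (10 * D * r).
  have ka0 : 0 < ka by rewrite expn_gt0.
  have T0p : 0 < T0 by rewrite expn_gt0.
  have r3 : r.+1 <= r.+1 ^ 3 by rewrite -{1}[r.+1]expn1 leq_pexp2l.
  have rT : 4 * r.+1 <= T0.
    by apply: leq_trans T; apply: leq_mul.
  have kT : kk <= T0 by apply: leq_trans rT; rewrite /kk /r; clear; lia.
  have rT1 : r <= T0 by apply: leq_trans rT; clear; lia.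
  have sT : s <= T0 by apply: leq_trans rT1.
  have M0 : 0 < M by rewrite /M addn_gt0 orbT.
  pose B0 := M * (T0 * T0 * (2 * ka)).
  have ka2 : 1 <= 2 * ka by rewrite muln_gt0.
  have TT : T0 <= T0 * T0 by rewrite leq_pmulr.
  have TTk a : a <= T0 * T0 -> a <= B0.
    move=> aT; rewrite /B0; apply: leq_trans aT _.
    by apply: leq_trans _ (leq_pmull _ M0); rewrite leq_pmulr.
  have MTk a : a <= T0 -> M * a <= B0.
    move=> aT; rewrite /B0 leq_mul2l; apply/orP; right; apply: leq_trans aT _.
    by apply: leq_trans TT _; rewrite leq_pmulr.
  have t1 : e <= B0.
    by apply: leq_trans (MTk 1 T0p); rewrite muln1 /M; clear; lia.
  have t2 := MTk _ kT.
  have t3 : kk * kk <= B0 by apply: TTk; apply: leq_mul.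
  have t4 : 2 * kk <= B0.
    by apply: TTk; apply: leq_mul => //; apply: leq_trans rT; clear; lia.
  have t5 : M * (r * k r * kk) <= B0.
    rewrite /B0 leq_mul2l; apply/orP; right; rewrite mulnAC; apply: leq_mul => //.
    exact: leq_mul.
  have t6 : M * (s * k s) <= B0.
    rewrite /B0 leq_mul2l; apply/orP; right; apply: leq_mul.
      exact: leq_trans sT TT.
    by rewrite leq_mul2l leq_pexp2l // leq_mul2l leqnSn orbT.
  apply: leq_trans (_ : 7 * B0 <= _); first by move: t1 t2 t3 t4 t5 t6; clear; lia.
  rewrite leq_divRL // -(leq_pmul2r (_ : 0 < 2 * T0)) ?muln_gt0 //.
  apply: leq_trans qT; apply: leq_trans m_ge.
  have -> : 7 * B0 * 4 * (2 * T0) = 112 * (T0 * T0 * T0) * (M * ka) by rewrite /B0; ring.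
  have Mka : M * ka <= 2 ^ e.
    apply: leq_trans He; rewrite leq_mul2l leq_pexp2l ?orbT //.
    move: Ds D20; rewrite /r -mulnA mulnS; move: (D * s) (D ^ 2); clear; lia.
  have -> : 3 * e = 2 * e + e by clear; lia.
  rewrite [2 ^ (2 * e + e)]expnD; apply: leq_mul => //.
  apply: leq_trans (_ : 2 ^ 7 * (T0 * T0 * T0) <= _); first by apply: leq_mul.
  rewrite /T0 -!expnD leq_pexp2l //.
  by move: De Ds D20; move: (D * s) (D ^ 2); clear; lia.
apply: leq_trans (_ : 2 ^ e * (2 ^ (M * kk) * (2 ^ (kk * kk) * (f * (2 ^ kk * (2 ^ kk *
   (2 ^ (M * (r * k r * kk)) * (2 ^ (M * (s * k s)) * 2 ^ ee))))))) <= _).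
  have k2 : kk <= 2 ^ kk by apply/ltnW/ltn_expl.
  have A1 : (m.+1 ^ (r * k r)) ^ kk <= 2 ^ (M * (r * k r * kk)) by rewrite -expnM.
  have A0 : 'C(m, kk) <= 2 ^ (M * kk) by apply: leq_trans (bin_le_pow _ _) _.
  by do 6![apply: leq_mul => //]; apply: leq_mul A1 _; apply: leq_mul (m1 _) _.
have -> : 2 ^ e * (2 ^ (M * kk) * (2 ^ (kk * kk) * (f * (2 ^ kk * (2 ^ kk *
   (2 ^ (M * (r * k r * kk)) * (2 ^ (M * (s * k s)) * 2 ^ ee))))))) =
   2 ^ (e + M * kk + kk * kk + 2 * kk + M * (r * k r * kk) + M * (s * k s) + ee) * f.
  by rewrite mul2n -addnn !expnD; ring.
rewrite leq_mul2r leq_pexp2l ?orbT //.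
by move: key qk split_e; rewrite /ee; clear; lia.
Qed.

(** A union bound over [s] sparse classes and one overlap class; the additional [2 ^ s] in
    [sparse_cut_rare] pays for the number of sparse classes. *)
Lemma nonpartite_rec (R : realType) :
  2 ^ e * #|Kfree_nonpartite_graphs r.+1 r m| <=
    2 ^ (w * (m - w - p)) * #|Kfree_graphs r.+1 (m - w)| +
    2 ^ (kk * (m - kk - p)) * #|Kfree_graphs r.+1 (m - kk)|.
Proof.
pose NP := Kfree_nonpartite_graphs r.+1 r m.
pose Xs (j : nat) := [set E in NP | `[< sparse_cut E (h' j) j w (w * p + 5 * m) >]].
pose Xo := [set E in NP | `[< overlap_cut E s (h r) (k r) (h s) (k s) kk ee >]].
have NPK E : E \in NP -> E \in Kfree_graphs r.+1 m by rewrite inE => /andP[].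
have sub : NP \subset (\bigcup_(j < s) Xs j.+1) :|: Xo.
  apply/subsetP => E EN; rewrite inE; apply: contraT; rewrite negb_or => /andP[ns no].
  move: (EN); rewrite !inE => /andP[/andP[gE kE] /negP[]].
  apply: (partite_of_no_cut R gE kE) => [[//|j] _ js sc|oc].
  - case/negP: ns; apply/bigcupP; exists (Ordinal js) => //.
    by rewrite inE EN; apply/asboolP.
  - by case/negP: no; rewrite inE EN; apply/asboolP.
apply: leq_trans (leq_mul (leqnn _) (subset_leq_card sub)) _.
apply: leq_trans (leq_mul (leqnn _) (leq_card_setU _ _)) _.
rewrite mulnDr; apply: leq_add; last first.
  by apply: overlap_cut_rare => E; rewrite inE => /andP[/NPK EK /asboolP].
have sc j : 2 ^ (e + s) * #|Xs j| <= 2 ^ (w * (m - w - p)) * #|Kfree_graphs r.+1 (m - w)|.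
  by apply: (sparse_cut_rare (j := j)) => E; rewrite inE => /andP[/NPK EK /asboolP].
have P : 0 < 2 ^ s by rewrite expn_gt0.
rewrite -(leq_pmul2l P) mulnA -expnD [s + e]addnC.
apply: leq_trans (leq_mul (leqnn _) (leq_card_bigcup_seq _ _ _)) _.
rewrite big_distrr /=.
apply: leq_trans (_ : \sum_(j < s) 2 ^ (w * (m - w - p)) * #|Kfree_graphs r.+1 (m - w)| <= _).
  by apply: leq_sum => j _; apply: sc.
rewrite sum_nat_const card_ord leq_mul2r; apply/orP; right.
exact/ltnW/ltn_expl.
Qed.

End Recursion.

(** * Induction on the number of vertices *)

Lemma Kfree_split q r n :
  #|Kfree_graphs q n| <= #|partite_graphs r n| + #|Kfree_nonpartite_graphs q r n|.
Proof.
apply: leq_trans (leq_card_setU _ _); apply/subset_leq_card/subsetP => E.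
by rewrite !inE => /andP[-> ->] /=; case: (partite r E).
Qed.

Lemma partite_Kfree r n : partite_graphs r n \subset Kfree_graphs r.+1 n.
Proof.
apply/subsetP => E; rewrite !inE => /andP[-> /existsP[f /forallP fE]] /=.
apply/negP => /existsP[K /andP[/eqP cK /forall_inP cl]].
have inj : {in K &, injective f}.
  move=> x y xK yK fxy; apply/eqP; apply: contraT => xy.
  move/forall_inP: (cl x xK) => /(_ y yK) /implyP /(_ xy) axy.
  move/forall_inP: (fE (f x)) => /(_ x); rewrite inE eqxx => /(_ isT) /forall_inP /(_ y).
  by rewrite inE fxy eqxx axy => /(_ isT).
have := max_card (mem (f @: K)); rewrite card_in_imset // cK card_ord.
by rewrite ltnn.
Qed.

Lemma card_Kfree_le q n : #|Kfree_graphs q n| <= 2 ^ (n * n).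
Proof.
apply: leq_trans (_ : #|powerset [set e : {set 'I_n} | e \subset [set: 'I_n] & #|e| == 2]| <= _).
  apply/subset_leq_card/subsetP => E; rewrite !inE => /andP[/forall_inP gE _].
  by apply/subsetP => e /gE; rewrite !inE subsetT.
rewrite card_powerset cards_draws cardsT card_ord leq_pexp2l // bin2 -divn2.
by apply: leq_trans (leq_div _ _) _; rewrite leq_mul2l leq_pred orbT.
Qed.

Lemma partite_graphs_gt0 r n : 0 < r -> 0 < #|partite_graphs r n|.
Proof.
case: r => // r _; rewrite card_gt0; apply/set0Pn; exists set0; rewrite inE.
apply/andP; split; first by apply/forall_inP => e; rewrite inE.
apply/existsP; exists [ffun _ => ord0]; apply/forallP => i.
by apply/forall_inP => x _; apply/forall_inP => y _; rewrite /adj inE.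
Qed.

Lemma partite_growth_sub r m k : 0 < r -> k <= m ->
  2 ^ (k * (m - k - m %/ r)) * #|partite_graphs r (m - k)| <= #|partite_graphs r m|.
Proof. by move=> r0 km; have := partite_growth_iter (m - k) k r0; rewrite subnK. Qed.

Section Induction.
Variables (R : realType) (s D e : nat).
Hypotheses (s0 : 0 < s) (sD : s + 21 <= D) (He : (8 * e + 8) * 2 ^ (40 * D ^ 2) <= 2 ^ e).
Let w := 2 ^ e.
Let m0 := 2 ^ (3 * e).
Let X := m0 * m0.
(** The bound to be proved for the ratio of the two counts: trivially true up to [m0], where [2 ^ X]
    exceeds the number of all graphs, with an excess over 2 that halves every [w] vertices until it
    reaches 1. *)
Let c m := 2 + 2 ^ (X - (m - m0) %/ w).

Lemma w_ge : 2 <= e /\ 2 * s + 3 <= w.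
Proof.
have De := D_sq_le_e He; have D20 := D_gt20 sD; have Ds := D_mul_le_sq sD (leqnn s).
have De2 : D <= e by move: De Ds; move: (D * s) (D ^ 2); clear; lia.
split; first by move: D20 De2; clear; lia.
apply: leq_trans (_ : 2 ^ D <= _); last by rewrite leq_pexp2l.
apply: leq_trans (_ : 2 ^ (s + 3) <= _); last by rewrite leq_pexp2l //; move: sD; clear; lia.
rewrite expnD; have : s < 2 ^ s by apply: ltn_expl.
by rewrite [2 ^ 3](_ : _ = 8) //; clear; lia.
Qed.

Lemma c_step m : c (m - w) <= 2 + 2 * 2 ^ (X - (m - m0) %/ w).
Proof.
rewrite /c leq_add2l -expnS leq_pexp2l //.
have w0 : 0 < w by rewrite expn_gt0.
have : (m - m0) %/ w <= (w + (m - w - m0)) %/ w.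
  by apply: leq_div2r; move: (w) (m0); clear; lia.
by rewrite divnDl // divnn w0; move: (_ %/ w) ((m - w - m0) %/ w); clear; lia.
Qed.

Lemma c_anti a b : a <= b -> c b <= c a.
Proof.
move=> ab; rewrite /c leq_add2l leq_pexp2l // leq_sub2l // leq_div2r //.
by rewrite leq_sub2r.
Qed.

(** Combines the recursion with the growth of the partite counts; [c] is nonincreasing and
    [kk <= w], so [c (m - w)] bounds both terms. *)
Lemma nonpartite_step m : m0 <= m -> m < 2 ^ (8 * e + 8) ->
  (forall a, a < m -> #|Kfree_graphs s.+2 a| <= c a * #|partite_graphs s.+1 a|) ->
  2 ^ e * #|Kfree_nonpartite_graphs s.+2 s.+1 m| <= 2 * c (m - w) * #|partite_graphs s.+1 m|.
Proof.
move=> mm mlt IH; have [e2 kw] := w_ge.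
have wm : w <= m by apply: leq_trans mm; rewrite /w /m0 leq_pexp2l //; clear; lia.
have w0 : 0 < w by rewrite expn_gt0.
apply: leq_trans (nonpartite_rec s0 sD He mm mlt R) _.
have st k : 0 < k -> k <= w ->
   2 ^ (k * (m - k - m %/ s.+1)) * #|Kfree_graphs s.+2 (m - k)| <=
     c (m - w) * #|partite_graphs s.+1 m|.
  move=> k0 kwk; have km := leq_trans kwk wm.
  apply: leq_trans (leq_mul (leqnn _) (IH (m - k) _)) _.
    by move: k0 km; clear; lia.
  rewrite mulnCA; apply: leq_mul; last exact: partite_growth_sub.
  by apply: c_anti; rewrite leq_sub2l.
rewrite -[2 * c _ * _]mulnA [2 * (c _ * _)]mul2n -addnn.
by apply: leq_add; apply: st => //; rewrite addn3.
Qed.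

(** With [t] the excess at [m], the excess at [m - w] is at most [2 * t]; as [4 <= 2 ^ e], the step
    bounds the nonpartite graphs by [1 + t] times the partite ones, and adding the partite ones
    gives [2 + t = c m]. *)
Lemma Kfree_bound m : m < 2 ^ (8 * e + 8) ->
  #|Kfree_graphs s.+2 m| <= c m * #|partite_graphs s.+1 m|.
Proof.
have [m1] := ubnP m; elim: m1 m => // m1 IH m mm1 mlt.
case: (ltnP m m0) => [small|big].
  apply: leq_trans (card_Kfree_le _ _) _.
  apply: leq_trans (_ : c m <= _); last by rewrite leq_pmulr // partite_graphs_gt0.
  rewrite /c (eqP (ltnW small : m - m0 == 0)) div0n subn0.
  apply: leq_trans (leq_addl _ _); rewrite leq_pexp2l //.
  by apply: leq_mul; apply: ltnW.
have {}IH a : a < m -> #|Kfree_graphs s.+2 a| <= c a * #|partite_graphs s.+1 a|.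
  by move=> am; apply: IH; [apply: leq_trans am _|apply: ltn_trans am _].
have st := nonpartite_step big mlt IH.
have [e2 _] := w_ge.
have cs := c_step m; set g := #|partite_graphs _ _| in st *.
set b := #|Kfree_nonpartite_graphs _ _ _| in st.
have b1 : b <= (1 + 2 ^ (X - (m - m0) %/ w)) * g.
  have e4 : 4 * b <= 2 ^ e * b by rewrite leq_mul2r (@leq_pexp2l 2 2 e) ?orbT.
  have := leq_trans (leq_trans e4 st) (leq_mul (leq_mul (leqnn 2) cs) (leqnn g)).
  move: (2 ^ (X - _)) => t; rewrite -[X in _ <= X -> _]mulnA.
  have -> : 2 * ((2 + 2 * t) * g) = 4 * ((1 + t) * g) by ring.
  by rewrite leq_mul2l.
apply: leq_trans (Kfree_split _ s.+1 _) _; rewrite -/g -/b.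
have -> : c m * g = g + (1 + 2 ^ (X - (m - m0) %/ w)) * g by rewrite /c; ring.
by rewrite leq_add2l.
Qed.

(** For [n >= 2 ^ (8 * e)] the excess has dropped to 1, because [w * X = 2 ^ (7 * e)]; so
    [c (n - w) <= 3], whence the constant 6. *)
Lemma nonpartite_small n : 2 ^ (8 * e) <= n -> n < 2 ^ (8 * e + 8) ->
  2 ^ e * #|Kfree_nonpartite_graphs s.+2 s.+1 n| <= 6 * #|Kfree_graphs s.+2 n|.
Proof.
move=> nge nlt; have [e2 _] := w_ge.
have mn : m0 <= n by apply: leq_trans nge; rewrite leq_pexp2l //; clear; lia.
apply: leq_trans (nonpartite_step mn nlt _) _.
  by move=> a an; apply: Kfree_bound; apply: ltn_trans an _.
apply: leq_mul; last by apply/subset_leq_card/partite_Kfree.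
rewrite -[6]/(2 * 3) leq_mul2l /c -[3]/(2 + 2 ^ 0) leq_add2l leq_pexp2l //.
rewrite leqn0 subn_eq0 leq_divRL ?expn_gt0 //.
rewrite -subnDA leq_subRL; last first.
  apply: leq_trans nge; rewrite /w /m0.
  apply: leq_trans (_ : 2 ^ (3 * e) + 2 ^ (3 * e) <= _).
    by rewrite leq_add2r leq_pexp2l //; clear; lia.
  by rewrite addnn -mul2n -expnS leq_pexp2l //; move: e2; clear; lia.
apply: leq_trans nge; rewrite /X /w /m0 -!expnD.
apply: leq_trans (_ : 2 ^ (7 * e) + 2 ^ (7 * e) + 2 ^ (7 * e) <= _).
  by rewrite !leq_add ?leq_pexp2l //; clear; lia.
apply: leq_trans (_ : 2 ^ 2 * 2 ^ (7 * e) <= _).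
  by rewrite [2 ^ 2](_ : _ = 4) //; clear; lia.
by rewrite -expnD leq_pexp2l //; move: e2; clear; lia.
Qed.
End Induction.

(** * Asymptotics of the parameters and the exceptional values of r *)

Lemma param_threshold : exists E0, forall e r, E0 <= e -> r ^ 4 <= 8 * e + 8 ->
  (8 * e + 8) * 2 ^ (40 * (r + 20) ^ 2) <= 2 ^ e.
Proof.
(* For [r < 54] the base [r + 20] is below 74. For [r >= 54] it is at most [2 * r], and
   [9 * 320 <= 54 ^ 2] compares the square with [r ^ 4]. *)
exists (80 * (74 * 74) + 40) => e r eE re.
have lin x : 7 <= x -> 16 * x + 16 <= 2 ^ x.
  elim: x => // x IH; case: (ltngtP x 6) => [|x6 _|-> //]; first by clear; lia.
  have := IH x6; rewrite expnS; clear; lia.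
have half : 8 * e + 8 <= 2 ^ (e %/ 2).
  have e1 : 7 <= e %/ 2 by rewrite leq_divRL //; move: eE; move: (80 * _); clear; lia.
  apply: leq_trans (lin _ e1); have := divn_eq e 2; have := ltn_pmod e (isT : 0 < 2).
  by move: (e %/ 2) (e %% 2); clear; lia.
apply: leq_trans (leq_mul half (leqnn _)) _; rewrite -expnD leq_pexp2l //.
suff: 80 * (r + 20) ^ 2 <= e.
  have := leq_trunc_div e 2; rewrite -[80]/(2 * 40) -mulnA.
  by move: (e %/ 2) (40 * _); clear; lia.
case: (ltnP r 54) => r54.
  apply: leq_trans (leq_trans (leq_addr _ _) eE).
  by rewrite leq_mul2l mulnn; apply/orP; right; apply: leq_expn_base; move: r54; clear; lia.
have r2 : 80 * (r + 20) ^ 2 <= 320 * r ^ 2.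
  rewrite -[320]/(80 * 4) -mulnA leq_mul2l -[4]/(2 ^ 2) -expnMn; apply/orP; right.
  by apply: leq_expn_base; move: r54; clear; lia.
apply: leq_trans r2 _.
have r4 : 54 ^ 2 * r ^ 2 <= r ^ 4.
  by rewrite -[4]/(2 + 2) expnD leq_mul2r leq_expn_base ?orbT.
have : 9 * (320 * r ^ 2) <= 9 * e.
  apply: leq_trans (_ : 54 ^ 2 * r ^ 2 <= _); first by rewrite mulnA leq_mul2r orbT.
  apply: leq_trans r4 (leq_trans re _); move: eE; move: (80 * _); clear; lia.
by rewrite leq_mul2l.
Qed.

Lemma nonpartite_graphs1 n : #|Kfree_nonpartite_graphs 2 1 n| = 0.
Proof.
apply/eqP; rewrite cards_eq0; apply/eqP/setP => E; rewrite !inE; apply/negbTE.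
apply/negP => /andP[/andP[/forall_inP gE kE] /negP[]].
apply/existsP; exists [ffun _ => ord0]; apply/forallP => i.
apply/forall_inP => x _; apply/forall_inP => y _; apply: contra kE => xy.
apply/existsP; exists [set x; y]; rewrite gE //=.
apply/forall_inP => a; rewrite !inE => aP; apply/forall_inP => b; rewrite !inE => bP.
apply/implyP; case/orP: aP => /eqP->; case/orP: bP => /eqP->; rewrite ?eqxx // => _.
by rewrite adjC.
Qed.

Lemma nonpartite_graphs0 n : 0 < n -> #|Kfree_nonpartite_graphs 1 0 n| = 0.
Proof.
case: n => // n _; apply/eqP; rewrite cards_eq0; apply/eqP/setP => E; rewrite !inE.
apply/negbTE/negP => /andP[/andP[_ /negP kE] _]; apply: kE.
apply/existsP; exists [set ord0]; rewrite cards1 /=.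
apply/forall_inP => a; rewrite !inE => /eqP->; apply/forall_inP => b; rewrite !inE => /eqP->.
by rewrite eqxx.
Qed.

Import Order.TTheory GRing.Theory Num.Theory.
Local Open Scope ring_scope.

(** Raising to the fourth power gives [r ^ 4 <= ln n], and [ln n <= M] because [n < 2 ^ M] and
    [2 <= expR 1]. *)
Lemma fourth_power_bound (R : realType) (r n M : nat) : (n < 2 ^ M)%N -> (0 < n)%N ->
  r%:R <= (ln n%:R : R) `^ (1 / 4) -> (r ^ 4 <= M)%N.
Proof.
move=> nM n0 hr; have np : (0 : R) < n%:R by rewrite ltr0n.
have ln0 : 0 <= ln n%:R :> R by rewrite ln_ge0 // ler1n.
rewrite -(ler_nat R) natrX.
apply: le_trans (_ : (ln n%:R `^ (1 / 4)) ^+ 4 <= _).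
  by rewrite lerXn2r // ?nnegrE ?ler0n ?powR_ge0.
rewrite -powR_mulrn ?powR_ge0 // -powRrM (_ : 1 / 4 * 4%:R = 1); last by field.
rewrite powRr1 // -ler_expR lnK ?posrE //.
apply: le_trans (_ : (2 ^ M)%:R <= _); first by rewrite ler_nat ltnW.
rewrite natrX -[M%:R]mul1r expRM_natr lerXn2r ?nnegrE ?ler0n ?expR_ge0 //.
exact: expR_ge2.
Qed.

Theorem theorem1p1 (R : realType) (r : nat -> nat)
  (hr : forall n : nat, (0 < n)%N -> (r n)%:R <= (ln n%:R : R) `^ (1 / 4)) :
  forall eps : R, 0 < eps ->
  exists n0 : nat, forall n : nat, (n0 <= n)%N ->
    #|Kfree_nonpartite_graphs (r n).+1 (r n) n|%:R
      <= eps * #|Kfree_graphs (r n).+1 n|%:R.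
Proof.
move=> eps eps0; pose N := Num.bound (6 / eps).
have hN : 6 / eps < N%:R by apply: archi_boundP; rewrite divr_ge0 // ltW.
have [E0 E0P] := param_threshold.
exists (2 ^ (8 * (E0 + N)))%N => n n0n.
have n0 : (0 < n)%N by apply: leq_trans n0n; rewrite expn_gt0.
(* This choice puts [n] between [2 ^ (8 * e)] and [2 ^ (8 * e + 8)]; [e >= N] then gives
   [6 <= eps * 2 ^ e]. *)
pose e := (trunc_log 2 n %/ 8)%N.
have /andP[tl1 tl2] := trunc_log_bounds (isT : (1 < 2)%N) n0.
have eE : (E0 + N <= e)%N.
  by rewrite leq_divRL // mulnC; apply: trunc_log_max.
have n_ge : (2 ^ (8 * e) <= n)%N.
  by apply: leq_trans tl1; rewrite leq_pexp2l // mulnC leq_trunc_div.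
have n_lt : (n < 2 ^ (8 * e + 8))%N.
  apply: leq_trans tl2 _; rewrite leq_pexp2l // mulnC -mulSnr; exact: ltn_ceil.
have r4 := fourth_power_bound n_lt n0 (hr n n0).
have := E0P _ _ (leq_trans (leq_addr _ _) eE) r4.
case: (r n) => [|[|s]] He.
- by rewrite nonpartite_graphs0 // mulr_ge0 ?ler0n // ltW.
- by rewrite nonpartite_graphs1 mulr_ge0 ?ler0n // ltW.
(* From [r = 2] on the counting argument applies with [D = r + 20]. *)
have sD : (s.+1 + 21 <= s.+2 + 20)%N by rewrite [(s.+2 + 20)%N]addSnnS.
have := nonpartite_small R (ltn0Sn s) sD He n_ge n_lt.
rewrite -(ler_nat R) !natrM => le.
have e6 : 6 <= eps * (2 ^ e)%:R.
  rewrite mulrC -ler_pdivrMr //; apply: le_trans (ltW hN) _; rewrite ler_nat.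
  apply: leq_trans (_ : e <= _)%N; first by apply: leq_trans eE; apply: leq_addl.
  exact/ltnW/ltn_expl.
have P : 0 < (2 ^ e)%:R :> R by rewrite ltr0n expn_gt0.
rewrite -(ler_pM2l P); apply: le_trans le _.
by rewrite mulrA [_ * eps]mulrC ler_wpM2r ?ler0n.
Qed.
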